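(* Let $\bar A=(A_0,A_1)$ be a compatible couple of (quasi-)Banach spaces with $A_0\cap A_1\neq\{0\}$. Let $0<\theta_0<\theta_1<1$, $0<q_0,r_0,r_1,r\le\infty$, $a,a_0,b_0,b_1\in SV$, and $\left\|s^{-1/r_0}\frac{b_0(s)}{a_0(s)}\right\|_{r_0,(1,\infty)}<\infty$. Put $c_0(t)=a_0(t)\left\|s^{-1/r_0}\frac{b_0(s)}{a_0(s)}\right\|_{r_0,(t,\infty)}$ and $\rho(t)=t^{\theta_1-\theta_0}\frac{c_0(t)}{b_1(t)}$ for $t>0$. (i) If $0<\theta<1$, then $$\left(\bar A^{\mathcal L}_{\theta_0,r_0,b_0,q_0,a_0},\bar A_{\theta_1,r_1,b_1}\right)_{\theta,r,a}\cong \bar A_{\eta,r,a^{\#}},$$ where $\eta=(1-\theta)\theta_0+\theta\theta_1$ and $a^{\#}(t)=c_0(t)^{1-\theta}b_1(t)^{\theta}a(\rho(t))$. (ii) If additionally $\left\|s^{-1/r}a(s)\right\|_{r,(0,1)}<\infty$, then $$\left(\bar A^{\mathcal L}_{\theta_0,r_0,b_0,q_0,a_0},\bar A_{\theta_1,r_1,b_1}\right)_{1,r,a}\cong \bar A^{\mathcal R}_{\theta_1,r,a^{\#},r_1,b_1},$$ where $a^{\#}(t)=b_1(t)a(\rho(t))$.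
   Context: For a compatible couple $\bar X=(X_0,X_1)$ of (quasi-)Banach spaces, $f\in X_0+X_1$ and $t>0$, $K(t,f)=K(t,f;\bar X)=\inf\{\|f_0\|_{X_0}+t\|f_1\|_{X_1}: f=f_0+f_1,\ f_i\in X_i\}$. $\|\cdot\|_{q,(c,d)}$ ($0<q\le\infty$) is the usual (quasi-)norm of the Lebesgue space $L_q$ on the interval $(c,d)$ with Lebesgue measure (variable of integration: the displayed variable; $1/\infty=0$). $SV$ is the set of positive Lebesgue measurable functions $b$ on $(0,\infty)$ that are slowly varying: for each $\varepsilon>0$, $t^{\varepsilon}b(t)$ is equivalent to an increasing function and $t^{-\varepsilon}b(t)$ is equivalent to a decreasing function, where two positive functions are equivalent if each is bounded by a constant multiple of the other. For $0\le\theta\le1$, $0<q\le\infty$, $b\in SV$, $\bar X_{\theta,q,b}=(X_0,X_1)_{\theta,q,b}$ (also written $\bar X_{\theta,q;b}$) is the space of $f\in X_0+X_1$ with $\|f\|=\left\|u^{-\theta-1/q}b(u)K(u,f)\right\|_{q,(0,\infty)}<\infty$. For $0<\sigma<1$, $0<r,q\le\infty$, $a,b\in SV$, $\bar X^{\mathcal L}_{\sigma,r,b,q,a}$ is the space of $f\in X_0+X_1$ with $\|f\|=\left\|t^{-1/r}\frac{b(t)}{a(t)}\left\|u^{-\sigma-1/q}a(u)K(u,f)\right\|_{q,(0,t)}\right\|_{r,(0,\infty)}<\infty$, and $\bar X^{\mathcal R}_{\sigma,r,b,q,a}$ is the space of $f\in X_0+X_1$ with $\|f\|=\left\|t^{-1/r}\frac{b(t)}{a(t)}\left\|u^{-\sigma-1/q}a(u)K(u,f)\right\|_{q,(t,\infty)}\right\|_{r,(0,\infty)}<\infty$.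 $X\cong Y$ means that $X$ and $Y$ are continuously embedded in each other (same space, equivalent quasi-norms). *)

(* Defs.v *)
From HB Require Import structures.
From mathcomp Require Import all_boot all_order all_algebra.
From mathcomp Require Import complex.
From mathcomp Require Import all_classical all_reals all_analysis.

Set Implicit Arguments.
Unset Strict Implicit.
Unset Printing Implicit Defensive.

Import Order.TTheory GRing.Theory Num.Theory.
Import numFieldNormedType.Exports.

Local Open Scope classical_set_scope.
Local Open Scope ring_scope.

(* [R] with the sigma-algebra of Lebesgue (not just Borel) measurable sets,
   the domain of [completed_lebesgue_measure]. *)
Definition lebesgueType (R : realType) :=
  caratheodory_type ((wlength (@idfun R))^*)%mu.

(* For [0 < q <= +oo], the L_q quasi-norm over [D], with value [+oo] when the
   function is not in L_q(D): extending by zero outside [D] changes neither the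
   integral nor the essential supremum of the absolute value.  For a function
   that is not Lebesgue measurable the library's integral is the supremum of
   the integrals of the simple functions below it. *)
Definition Lq (R : realType) (q : \bar R) (D : set R) (g : R -> \bar R)
    : \bar R :=
  Lnorm (@completed_lebesgue_measure R) q (g \_ D : lebesgueType R -> \bar R).

(* [1/q], with [1/+oo = 0]. *)
Definition rinv (R : realType) (q : \bar R) : R := fine (q^-1)%E.

(* Functions on (0, +oo) are functions on [R] whose values outside (0, +oo)
   are never used. *)
Definition equiv_fun (R : realType) (f g : R -> R) : Prop :=
  exists C : R, forall t, 0 < t -> f t <= C * g t /\ g t <= C * f t.

(* Up to [equiv_fun], monotone and strictly monotone amount to the same here,
   since [eps] is arbitrary. *)
Definition slowly_varying (R : realType) (b : R -> R) : Prop :=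
  [/\ forall t, 0 < t -> 0 < b t,
      measurable_fun (`]0, +oo[%classic : set (lebesgueType R))
        (b : lebesgueType R -> R) &
      forall eps : R, 0 < eps ->
        (exists g : R -> R,
          [/\ forall t, 0 < t -> 0 < g t,
              forall s t, 0 < s -> s <= t -> g s <= g t &
              equiv_fun (fun t => t `^ eps * b t) g]) /\
        (exists g : R -> R,
          [/\ forall t, 0 < t -> 0 < g t,
              forall s t, 0 < s -> s <= t -> g t <= g s &
              equiv_fun (fun t => t `^ (- eps) * b t) g])].

Variant scalar_kind := RealScalars | ComplexScalars.

Definition scalars (R : realType) (k : scalar_kind) : numFieldType :=
  match k with RealScalars => R | ComplexScalars => R[i] end.

Definition modulus (R : realType) (k : scalar_kind) : scalars R k -> R :=
  match k return scalars R k -> R with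
  | RealScalars => fun z : R => `|z|
  | ComplexScalars => fun z : R[i] => complex.Re `|z|
  end.

(* A quasi-normed space realized inside an ambient space [V]; only the values
   of [qnorm] on the carrier matter. *)
Record qspace (R : realType) (V : Type) := QSpace {
  carrier :> V -> Prop ;
  qnorm : V -> \bar R
}.

Section Couples.
Context {R : realType} {k : scalar_kind}.
Local Open Scope ereal_scope.

Definition quasi_normed (V : lmodType (scalars R k)) (X : qspace R V) : Prop :=
  [/\ X 0%R,
      forall x y, X x -> X y -> X (x + y)%R &
      forall (c : scalars R k) x, X x -> X (c *: x)%R] /\
  [/\ forall x, X x -> 0 <= qnorm X x < +oo,
      forall x, X x -> qnorm X x = 0 -> x = 0%R,
      forall (c : scalars R k) x, X x ->
        qnorm X (c *: x)%R = (modulus c)%:E * qnorm X x &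
      exists C : R, forall x y, X x -> X y ->
        qnorm X (x + y)%R <= C%:E * (qnorm X x + qnorm X y)].

Definition qcomplete (V : lmodType (scalars R k)) (X : qspace R V) : Prop :=
  forall u : nat -> V, (forall n, X (u n)) ->
    (forall e : R, (0 < e)%R -> exists N : nat, forall m n : nat,
       (N <= m)%N -> (N <= n)%N -> qnorm X (u m - u n)%R < e%:E) ->
    exists2 x, X x & forall e : R, (0 < e)%R -> exists N : nat, forall n : nat,
       (N <= n)%N -> qnorm X (u n - x)%R < e%:E.

Definition quasi_banach (V : lmodType (scalars R k)) (X : qspace R V) : Prop :=
  quasi_normed X /\ qcomplete X.

(* Continuity at 0, hence everywhere, of the linear inclusion of [X] in [V]. *)
Definition continuously_included (V : topologicalLmodType (scalars R k))
    (X : qspace R V) : Prop :=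
  forall U : set V, nbhs (0%R : V) U ->
    exists2 d : R, (0 < d)%R & forall x, X x -> qnorm X x < d%:E -> U x.

Definition compatible_couple (V : topologicalLmodType (scalars R k))
    (X0 X1 : qspace R V) : Prop :=
  [/\ hausdorff_space V, quasi_banach X0, quasi_banach X1,
      continuously_included X0 & continuously_included X1].

End Couples.

Section Embeddings.
Context {R : realType} {V : Type}.
Local Open Scope ereal_scope.

Definition embedded (X Y : qspace R V) : Prop :=
  carrier X `<=` carrier Y /\
  exists C : R, forall f, X f -> qnorm Y f <= C%:E * qnorm X f.

Definition isomorphic (X Y : qspace R V) : Prop :=
  embedded X Y /\ embedded Y X.

End Embeddings.

Section Interpolation.
Context {R : realType} {V : nmodType}.
Implicit Types (X : qspace R V) (q r : \bar R) (a b : R -> R).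
Local Open Scope ereal_scope.

Definition sumset X0 X1 : set V :=
  [set f | exists f0 f1, [/\ X0 f0, X1 f1 & f = (f0 + f1)%R]].

Definition Kfun X0 X1 (t : R) (f : V) : \bar R :=
  ereal_inf [set s | exists f0 f1, [/\ X0 f0, X1 f1, f = (f0 + f1)%R &
                       s = qnorm X0 f0 + t%:E * qnorm X1 f1]].

Definition finite_part X0 X1 (N : V -> \bar R) : qspace R V :=
  QSpace [set f | sumset X0 X1 f /\ N f < +oo] N.

Definition weightedK X0 X1 (theta : R) q b (f : V) (u : R) : \bar R :=
  (u `^ (- theta - rinv q) * b u)%:E * Kfun X0 X1 u f.

Definition interp X0 X1 (theta : R) q b : qspace R V :=
  finite_part X0 X1
    (fun f => Lq q `]0%R, +oo[%classic (weightedK X0 X1 theta q b f)).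

Definition interpL X0 X1 (sigma : R) r b q a : qspace R V :=
  finite_part X0 X1 (fun f => Lq r `]0%R, +oo[%classic (fun t =>
    (t `^ (- rinv r) * (b t / a t))%:E *
      Lq q `]0%R, t[%classic (weightedK X0 X1 sigma q a f))).

Definition interpR X0 X1 (sigma : R) r b q a : qspace R V :=
  finite_part X0 X1 (fun f => Lq r `]0%R, +oo[%classic (fun t =>
    (t `^ (- rinv r) * (b t / a t))%:E *
      Lq q `]t, +oo[%classic (weightedK X0 X1 sigma q a f))).

End Interpolation.

Section Weights.
Context {R : realType}.
Implicit Types (r : \bar R) (a b c : R -> R).

(* [|| s^(-1/r) w(s) ||] in L_r(D). *)
Definition wnorm r (D : set R) (w : R -> R) : \bar R :=
  Lq r D (fun s => (s `^ (- rinv r) * w s)%:E).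

(* For slowly varying [a0], [b0] the norm is finite for every [t > 0] as soon as
   it is for [t = 1], so [fine] loses nothing. *)
Definition tail_weight r0 b0 a0 (t : R) : R :=
  a0 t * fine (wnorm r0 `]t, +oo[%classic (fun s => b0 s / a0 s)).

Definition rho_weight (theta0 theta1 : R) c0 b1 (t : R) : R :=
  t `^ (theta1 - theta0) * (c0 t / b1 t).

End Weights.

(* Main.v *)
Require Import Defs.
From mathcomp Require Import all_boot all_order all_algebra.
From mathcomp Require Import complex.
From mathcomp Require Import all_classical all_reals all_analysis.
From mathcomp Require Import measurable_realfun ess_sup_inf.
From mathcomp Require Import ring lra zify.

(* All quasi-norms are discretized at the points [expR n] for [n : int], where
   they become nested sequence quasi-norms of [K(expR n, f)] with regularly
   varying weights.  Write [K_n = K(expR n, f)] and [rho_n = rho(expR n)].  An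
   almost optimal decomposition of [f] for [K_n] gives Holmstedt's formula for
   [K(rho_n, f)] with respect to the new couple as a sum of three terms
   [part1], [part2], [part3]; the last one is [rho_n] times the tail at [n] of
   the discretized norm of the second space.  Discrete Hardy inequalities show
   that the weighted l_r norm of the sum is equivalent to the one of [part3]
   alone, for every [0 < theta <= 1].  Since [rho_n] grows geometrically, the
   points [rho_n] serve as well as the points [expR n] to discretize the norm
   of the interpolation space on the left-hand side.  For [theta = 1] the norm
   of [part3] is the norm on the right-hand side; for [theta < 1] one more
   Hardy inequality replaces [part3] by its first term.  All comparisons between
   sequences reduce to kernels bounded by [C * expR (- e * |i - j|)]. *)

Set Implicit Arguments.
Unset Strict Implicit.
Unset Printing Implicit Defensive.

Import Order.TTheory GRing.Theory Num.Theory.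
Import numFieldNormedType.Exports.

Local Open Scope classical_set_scope.
Local Open Scope ring_scope.

(** Two obstacles shape the proof. The exponents range over all of ]0, +oo], so neither Minkowski's
    inequality nor duality is at hand; decaying kernels replace them. And K(t, f) enters integrands
    that are never shown to be measurable; comparing them with step functions on the intervals [expR
    n, expR (n + 1)[ uses only monotonicity of the integral.

    The three terms come from cutting f = g + h at n. Since K_j of g is bounded by K_min(j,n) of f,
    the inner norm of g stops growing at n: the outer levels m <= n give [part1], while the levels
    beyond n all see the inner norm at n, weighted by the tail of b_0/a_0. This is [part2], and it
    is how that tail enters c_0. For j < n, K_j of h is linear in expR j, which is summable because
    theta_1 < 1, so h costs only [part3]. From below, only [part3] has to be bounded by K(rho_n, f):
    its diagonal term dominates [part2] after a Hardy inequality, and [part2] dominates [part1]. The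
    tail in [part3] carries a weight of exponent (1 - theta)(theta_1 - theta_0). It grows
    geometrically for theta < 1 and the tail can be summed away; for theta = 1 the growth is lost
    and the tail survives as the R space. *)

Section PowerLemmas.
Local Open Scope ereal_scope.
Context {R : realType}.
Implicit Types (x y : \bar R) (p : R).

Lemma poweR_le p x y : (0 <= p)%R -> 0 <= x -> x <= y -> x `^ p <= y `^ p.
Proof.
move=> p0 x0 xy; apply: gt0_ler_poweR => //; rewrite in_itv /= ?leey ?x0 //.
by rewrite (le_trans x0 xy).
Qed.

Lemma poweRK p x : (0 < p)%R -> 0 <= x -> (x `^ p) `^ p^-1 = x.
Proof. by move=> p0 x0; rewrite -poweRrM mulfV ?gt_eqF // poweRe1. Qed.

Lemma poweRVK p x : (0 < p)%R -> 0 <= x -> (x `^ p^-1) `^ p = x.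
Proof. by move=> p0 x0; rewrite -poweRrM mulVf ?gt_eqF // poweRe1. Qed.

Lemma poweR_leP p x y : (0 < p)%R -> 0 <= x -> 0 <= y ->
  x `^ p <= y `^ p -> x <= y.
Proof.
move=> p0 x0 y0 /(@poweR_le p^-1).
by rewrite !poweRK // invr_ge0 (ltW p0) poweR_ge0 => /(_ isT isT).
Qed.

(** Replacing both summands by the larger one works for every exponent, also below 1, where
    convexity is lost. *)
Lemma poweRD_le p x y : (0 <= p)%R -> 0 <= x -> 0 <= y ->
  (x + y) `^ p <= (2 `^ p)%:E * (x `^ p + y `^ p).
Proof.
move=> p0.
wlog xy : x y / x <= y => [h x0 y0|x0 y0].
  by case/orP: (le_total x y) => ?; [exact: h|rewrite addeC [X in _ * X]addeC; exact: h].
apply: (@le_trans _ _ ((2%:E * y) `^ p)).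
  apply: poweR_le => //; first exact: adde_ge0.
  by rewrite (_ : 2%:E = 1 + 1) ?ge0_muleDl ?mul1e ?lee_fin // leeD2r.
rewrite poweRM // ?lee_fin // poweR_EFin lee_pmul2l ?lte_fin ?powR_gt0 //.
by rewrite leeDr // poweR_ge0.
Qed.

End PowerLemmas.

Section EsumLemmas.
Local Open Scope ereal_scope.
Context {R : realType}.

Lemma le_esumZl (I : choiceType) (c : \bar R) (a : I -> \bar R) :
  0 <= c -> (forall i, 0 <= a i) ->
  \esum_(i in setT) (c * a i) <= c * \esum_(i in setT) a i.
Proof.
move=> c0 a0; apply: ge_ereal_sup => _ [F FS <-].
rewrite -ge0_mule_fsumr //; apply: lee_wpmul2l => //.
by apply: esum_ge; exists F.
Qed.

Lemma esum_exchange (I J : choiceType) (a : I -> J -> \bar R) :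
  (forall i j, 0 <= a i j) ->
  \esum_(i in setT) \esum_(j in setT) a i j =
  \esum_(j in setT) \esum_(i in setT) a i j.
Proof.
move=> a0; rewrite !esum_esum //.
rewrite (@reindex_esum _ (J * I)%type (I * J)%type
  ([set: J] `*`` (fun=> [set: I])) _ (fun p => (p.2, p.1))) //.
by split => //= [[j1 i1] [j2 i2] /= _ _ [-> ->]|[i j] _] //; exists (j, i).
Qed.

Lemma esum_gee (I : choiceType) (a : I -> \bar R) i :
  (forall i, 0 <= a i) -> a i <= \esum_(j in setT) a j.
Proof.
move=> a0; apply: esum_ge; exists [set i]; last by rewrite fsbig_set1.
by split.
Qed.

End EsumLemmas.

(** * Sequence quasi-norms over the integers *)

Section SequenceNorm.
Local Open Scope ereal_scope.
Context {R : realType}.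
Implicit Types (r q : \bar R) (x y : int -> \bar R).

(** Meant for nonnegative sequences, hence without absolute values. The branch at [-oo] is a default
    that [0 < r] excludes. *)
Definition lnorm r x : \bar R :=
  match r with
  | p%:E => (\esum_(n in setT) (x n `^ p)) `^ p^-1
  | +oo => ereal_sup (range x)
  | -oo => 0
  end.

Lemma lnorm_ge0 r x : (forall n, 0 <= x n) -> 0 <= lnorm r x.
Proof.
case: r => [p| |] x0 //=; first exact: poweR_ge0.
by apply: (le_trans (x0 0%R)); apply: ereal_sup_ubound; exists 0%R.
Qed.

Lemma lnorm_pow p x : (0 < p)%R ->
  lnorm p%:E x `^ p = \esum_(n in setT) (x n `^ p).
Proof.
by move=> p0; rewrite poweRVK // esum_ge0 // => *; rewrite poweR_ge0.
Qed.

Lemma lnorm_leP p x A : (0 < p)%R -> (forall n, 0 <= x n) -> 0 <= A ->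
  \esum_(n in setT) (x n `^ p) <= A `^ p -> lnorm p%:E x <= A.
Proof.
move=> p0 x0 A0 h; apply: (@poweR_leP _ p) => //; first exact: lnorm_ge0.
by rewrite lnorm_pow.
Qed.

Lemma lnorm_le r x y : (forall n, 0 <= x n) -> (forall n, x n <= y n) ->
  0 < r -> lnorm r x <= lnorm r y.
Proof.
move=> x0 xy; case: r => [p| |] //=; rewrite ?lte_fin => p0.
  apply: poweR_le; rewrite ?invr_ge0 ?(ltW p0) //.
    by apply: esum_ge0 => *; rewrite poweR_ge0.
  by apply: le_esum => n _; apply: poweR_le => //; exact: ltW.
apply: ge_ereal_sup => _ [n _ <-]; apply: (le_trans (xy n)).
by apply: ereal_sup_ubound; exists n.
Qed.

Lemma le_lnorm r x n : (forall n, 0 <= x n) -> 0 < r -> x n <= lnorm r x.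
Proof.
move=> x0; case: r => [p| |] //; rewrite ?lte_fin => p0.
  apply: (@poweR_leP _ p) => //; first exact: lnorm_ge0.
  by rewrite lnorm_pow //; apply: (esum_gee (a := fun n => x n `^ p)) => *; rewrite poweR_ge0.
by apply: ereal_sup_ubound; exists n.
Qed.

(** The factor is an extended real because it will itself be the norm of another sequence, possibly
    infinite. *)
Lemma lnormZ_le r (c : \bar R) x : 0 < r -> 0 <= c -> (forall n, 0 <= x n) ->
  lnorm r (fun n => c * x n) <= c * lnorm r x.
Proof.
move=> r0 c0 x0; case: r r0 => [p| |] //; rewrite ?lte_fin => p0.
  apply: lnorm_leP => // [n| |]; rewrite ?mule_ge0 ?lnorm_ge0 //.
  rewrite poweRM // ?lnorm_ge0 // lnorm_pow //.
  refine (le_trans _ (le_esumZl _ _)); rewrite ?poweR_ge0 //.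
    by apply: le_esum => n _; rewrite poweRM.
  by move=> i; rewrite poweR_ge0.
apply: ge_ereal_sup => _ [n _ <-]; apply: lee_wpmul2l => //.
by apply: ereal_sup_ubound; exists n.
Qed.

Lemma lnormZ r (c : R) x : 0 < r -> (0 < c)%R -> (forall n, 0 <= x n) ->
  lnorm r (fun n => c%:E * x n) = c%:E * lnorm r x.
Proof.
move=> r0 c0 x0; apply/eqP; rewrite eq_le lnormZ_le ?lee_fin ?(ltW c0) //=.
rewrite -lee_pdivlMl //.
have y0 n : 0 <= c%:E * x n by rewrite mule_ge0 // lee_fin ltW.
apply: le_trans (@lnormZ_le r (c^-1)%:E _ r0 _ y0); last by rewrite lee_fin invr_ge0 ltW.
by apply: lnorm_le => // n; rewrite muleA -EFinM mulVf ?gt_eqF // mul1e.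
Qed.

Lemma lnormZ_ge r (c : \bar R) x : 0 < r -> 0 <= c -> (forall n, 0 <= x n) ->
  c * lnorm r x <= lnorm r (fun n => c * x n).
Proof.
move=> r0 c0 x0.
have cx0 n : 0 <= c * x n by rewrite mule_ge0.
case: c c0 cx0 => [c| |] // c0 cx0.
  have /orP[/eqP c00|cp] : (0 == c%:E) || (0 < c%:E) by rewrite -le_eqVlt.
    by rewrite -c00 mul0e lnorm_ge0 // => n; rewrite mul0e.
  by rewrite lnormZ.
have [x00|/existsNP[n xn]] := pselect (forall n, x n = 0).
  suff -> : lnorm r x = 0 by rewrite mule0 lnorm_ge0.
  apply/le_anti; rewrite lnorm_ge0 // andbT -(mul0e (lnorm r x)).
  apply: le_trans (lnormZ_le r0 (lexx 0) x0).
  by apply: lnorm_le => // n; rewrite x00 mul0e.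
have xn0 : 0 < x n by rewrite lt_neqAle x0 andbT eq_sym; exact/eqP.
apply: le_trans (le_lnorm n cx0 r0).
by rewrite [leRHS]gt0_mulye // leey.
Qed.

Lemma lnormD r : 0 < r -> exists2 A : R, (0 < A)%R & forall x y,
  (forall n, 0 <= x n) -> (forall n, 0 <= y n) ->
  lnorm r (fun n => x n + y n) <= A%:E * (lnorm r x + lnorm r y).
Proof.
case: r => [p| |] //; rewrite ?lte_fin => p0; last first.
  exists 1%R => // x y x0 y0; rewrite mul1e.
  by apply: ge_ereal_sup => _ [n _ <-]; apply: leeD; exact: le_lnorm.
(* The factor 2 is the p-th root of the constant in [poweRD_le]. The factor 2^(1/p) comes from
   bounding the sum of the p-th powers of the two norms by twice the p-th power of their sum. *)
exists (2 * 2 `^ p^-1)%R; first by rewrite mulr_gt0 // powR_gt0.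
move=> x y x0 y0.
have X0 := lnorm_ge0 p%:E x0; have Y0 := lnorm_ge0 p%:E y0.
have A0 : (0 <= 2 * 2 `^ p^-1 :> R)%R by rewrite mulr_ge0 // powR_ge0.
apply: lnorm_leP => // [n| |]; rewrite ?adde_ge0 ?mule_ge0 ?adde_ge0 //.
rewrite poweRM ?adde_ge0 // poweR_EFin powRM ?powR_ge0 // -powRrM.
rewrite mulVf ?gt_eqF // powRr1 // EFinM -muleA.
apply: (@le_trans _ _ ((2 `^ p)%:E * (\esum_(n in setT) (x n `^ p + y n `^ p)))).
  refine (le_trans _ (le_esumZl _ _)); rewrite ?lee_fin ?powR_ge0 //.
    by apply: le_esum => n _; apply: poweRD_le => //; exact: ltW.
  by move=> n; rewrite adde_ge0 ?poweR_ge0.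
apply: lee_wpmul2l; first by rewrite lee_fin powR_ge0.
rewrite esumD; try by move=> *; rewrite poweR_ge0.
rewrite -!lnorm_pow // (_ : 2%:E = 1 + 1) // ge0_muleDl ?mul1e ?lee_fin //.
by apply: leeD; apply: poweR_le => //; rewrite ?(ltW p0) // ?leeDl ?leeDr.
Qed.

(* Schur's test in the trivial case where the same exponent is used twice. *)
Lemma lnorm_schur r (A : R) (k : int -> int -> R) x : 0 < r -> (0 <= A)%R ->
  (forall i j, 0 <= k i j)%R -> (forall n, 0 <= x n) ->
  (forall j, lnorm r (fun i => (k i j)%:E) <= A%:E) ->
  lnorm r (fun i => lnorm r (fun j => (k i j)%:E * x j)) <= A%:E * lnorm r x.
Proof.
move=> r0 A0 k0 x0 hk.
have kx0 i j : 0 <= (k i j)%:E * x j by rewrite mule_ge0 ?lee_fin.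
have kn0 i : 0 <= lnorm r (fun j => (k i j)%:E * x j) by exact: lnorm_ge0.
case: r r0 hk kn0 => [p| |] //; rewrite ?lte_fin => p0 hk kn0; last first.
  apply: ge_ereal_sup => _ [i _ <-]; apply: ge_ereal_sup => _ [j _ <-].
  apply: lee_pmul; rewrite ?lee_fin //; last exact: le_lnorm.
  by rewrite -lee_fin; apply: le_trans (hk j); apply: le_lnorm => // n; rewrite lee_fin.
apply: lnorm_leP => //; first by rewrite mule_ge0 // lnorm_ge0.
under eq_esum do rewrite lnorm_pow //.
rewrite esum_exchange; last by move=> *; rewrite poweR_ge0.
rewrite poweRM ?lnorm_ge0 // lnorm_pow //.
refine (le_trans _ (le_esumZl _ _)); rewrite ?poweR_ge0 //; last first.
  by move=> *; rewrite poweR_ge0.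
apply: le_esum => j _.
under eq_esum do rewrite poweRM ?lee_fin // muleC.
refine (le_trans (le_esumZl _ _) _); rewrite ?poweR_ge0 //.
  by move=> i; rewrite poweR_ge0.
rewrite muleC; apply: lee_wpmul2r; first by rewrite poweR_ge0.
rewrite -lnorm_pow //; apply: poweR_le => //; first exact: ltW.
by apply: lnorm_ge0 => i; rewrite lee_fin.
Qed.

End SequenceNorm.

(** * Exponentially decaying kernels and Hardy inequalities *)

Section GeometricKernels.
Local Open Scope ereal_scope.
Context {R : realType}.

Lemma esum_geometric_le (c : R) : (0 < c)%R ->
  \esum_(k in [set: nat]) (expR (- c * k%:R))%:E <= ((1 - expR (- c))^-1)%:E.
Proof.
move=> c0; have z1 : (expR (- c) < 1)%R by rewrite expR_lt1 oppr_lt0.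
rewrite -nneseries_esumT; last by move=> n; rewrite lee_fin expR_ge0.
apply: lime_le; first by apply: is_cvg_nneseries => n _ _; rewrite lee_fin expR_ge0.
apply: nearW => n; rewrite sumEFin lee_fin.
have := @geometric_le_lim R n 1%R (expR (- c)) ler01 (expR_gt0 _).
rewrite ger0_norm ?expR_ge0 // mul1r => /(_ z1); apply: le_trans.
rewrite /series /= le_eqVlt; apply/orP; left; apply/eqP.
by apply: eq_bigr => k _; rewrite mul1r -expRM_natl mulrC.
Qed.

Lemma esum_int_split (n : int) (a : int -> \bar R) : (forall m, 0 <= a m) ->
  \esum_(m in setT) a m = \esum_(k in [set: nat]) a (n + k%:Z)%R +
                          \esum_(k in [set: nat]) a (n - 1 - k%:Z)%R.
Proof.
move=> a0; rewrite (esumID [set m | (n <= m)%R]) //; congr (_ + _).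
  rewrite setTI -(esum_image setT (fun k : nat => n + k%:Z)%R); last first.
    by move=> i j _ _ /= /addrI [].
  congr esum; apply/seteqP; split => m /=.
    by move=> nm; exists (absz (m - n)%R) => //; lia.
  by move=> [k _ <-]; lia.
rewrite setTI -(esum_image setT (fun k : nat => n - 1 - k%:Z)%R); last first.
  by move=> i j _ _ /= /addrI /oppr_inj [].
congr esum; apply/seteqP; split => m /=.
  by move=> nm; exists (absz (n - 1 - m)%R) => //; lia.
by move=> [k _ <-]; lia.
Qed.

(** The bound is uniform in a real centre [x], not only an integer one, because the points ln rho_n
    serve as centres later. *)
Lemma lnorm_geo (r : \bar R) (e : R) : 0 < r -> (0 < e)%R ->
  exists2 A : R, (0 < A)%R & forall x : R,
  lnorm r (fun m : int => (expR (- e * `|m%:~R - x|))%:E) <= A%:E.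
Proof.
case: r => [p| |] //; rewrite ?lte_fin => p0 e0; last first.
  exists 1%R => // x; apply: ge_ereal_sup => _ [m _ <-].
  by rewrite lee_fin -expR0 ler_expR mulNr oppr_le0 mulr_ge0 // ltW.
have pe0 : (0 < e * p)%R by rewrite mulr_gt0.
have z1 : (expR (- (e * p)) < 1)%R by rewrite expR_lt1 oppr_lt0.
set B := (expR (e * p) * (1 - expR (- (e * p)))^-1)%R.
have B0 : (0 < B)%R by rewrite mulr_gt0 ?expR_gt0 // invr_gt0 subr_gt0.
exists ((2 * B) `^ p^-1)%R; first by rewrite powR_gt0 // mulr_gt0.
move=> x; apply: lnorm_leP => //; rewrite ?lee_fin ?powR_ge0 //.
rewrite -poweR_EFin poweRVK // ?lee_fin; last by rewrite mulr_ge0 // ltW.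
rewrite (esum_int_split (Num.floor x)); last by move=> m; rewrite poweR_ge0.
have := floor_le x; have := floorD1_gt x; rewrite intrD.
set n := (Num.floor x : int); move=> xn1 nx.
(* The k-th integer on either side of [Num.floor x] has distance at least k - 1 from [x]; the lost
   unit is paid by the factor [expR (e * p)] in [B]. *)
have geo (u : nat -> int) : (forall k, k%:R - 1 <= `|(u k)%:~R - x|)%R ->
    \esum_(k in [set: nat]) (expR (- e * `|(u k)%:~R - x|))%:E `^ p <= B%:E.
  move=> hu; apply: (@le_trans _ _ (\esum_(k in [set: nat])
      ((expR (e * p))%:E * (expR (- (e * p) * k%:R))%:E))).
    apply: le_esum => k _; rewrite poweR_EFin lee_fin -expRM -expRD ler_expR.
    have := hu k; nra.
  refine (le_trans (le_esumZl _ _) _); rewrite ?lee_fin ?expR_ge0 //.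
  by rewrite EFinM lee_wpmul2l ?lee_fin ?expR_ge0 //; exact: esum_geometric_le.
rewrite mulr_natl mulr2n EFinD; apply: leeD; apply: geo => k.
  rewrite intrD (le_trans _ (ler_norm _)) //; rewrite -[(k%:Z)%:~R]/(k%:R); lra.
rewrite ler0_norm ?intrD ?rmorphN /=; rewrite -[(k%:Z)%:~R]/(k%:R); last first.
  have := ler0n R k; lra.
lra.
Qed.

Lemma lnorm_conv (r : \bar R) (e C : R) : 0 < r -> (0 < e)%R -> (0 < C)%R ->
  exists2 A : R, (0 < A)%R & forall x : int -> \bar R, (forall n, 0 <= x n) ->
  lnorm r (fun i => lnorm r (fun j =>
    (C * expR (- e * `|i%:~R - j%:~R|))%:E * x j)) <= A%:E * lnorm r x.
Proof.
move=> r0 e0 C0; have [A A0 hA] := lnorm_geo r0 e0.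
exists (C * A)%R => [|x x0]; first exact: mulr_gt0.
apply: lnorm_schur => //; first by rewrite mulr_ge0 // ltW.
  by move=> i j; rewrite mulr_ge0 ?expR_ge0 // ltW.
move=> j.
under eq_fun do rewrite EFinM.
rewrite lnormZ //.
by rewrite EFinM lee_wpmul2l // lee_fin ltW.
Qed.

(** The single term [j] is bounded by the whole inner norm in [lnorm_conv]. The choice of [j] need
    not be injective in [i]: the decay pays for repetitions, for instance when all large [i] point
    to one index. *)
Lemma lnorm_dom (r : \bar R) (e C : R) : 0 < r -> (0 < e)%R -> (0 < C)%R ->
  exists2 A : R, (0 < A)%R & forall x y : int -> \bar R,
  (forall n, 0 <= x n) -> (forall n, 0 <= y n) ->
  (forall i, exists j,
    y i <= (C * expR (- e * `|i%:~R - j%:~R|))%:E * x j) ->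
  lnorm r y <= A%:E * lnorm r x.
Proof.
move=> r0 e0 C0; have [A A0 hA] := lnorm_conv r0 e0 C0; exists A => // x y x0 y0 xy.
apply: le_trans (hA x x0); apply: lnorm_le => // i.
have [j hj] := xy i; apply: (le_trans hj).
apply: (@le_lnorm _ r (fun j => (C * expR (- e * `|i%:~R - j%:~R|))%:E * x j)) => // n.
by rewrite mule_ge0 // lee_fin mulr_ge0 ?expR_ge0 // ltW.
Qed.

(* Off-diagonal decay makes the inner exponent irrelevant: half of the decay
   bounds the inner norm by a supremum, hence by the outer norm, and the other
   half is left for Schur's test.  This contains all the Hardy inequalities
   needed, also for exponents below 1. *)
Lemma lnorm_hardy (q r : \bar R) (e C : R) :
  0 < q -> 0 < r -> (0 < e)%R -> (0 < C)%R ->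
  exists2 A : R, (0 < A)%R & forall (x : int -> \bar R) (y : int -> int -> \bar R),
  (forall n, 0 <= x n) -> (forall i j, 0 <= y i j) ->
  (forall i j, y i j <= (C * expR (- e * `|i%:~R - j%:~R|))%:E * x j) ->
  lnorm r (fun i => lnorm q (y i)) <= A%:E * lnorm r x.
Proof.
move=> q0 r0 e0 C0; have e20 : (0 < e / 2)%R by rewrite divr_gt0.
have [A A0 hA] := lnorm_conv r0 e20 C0.
have [B B0 hB] := lnorm_geo q0 e20.
exists (B * A)%R => [|x y x0 y0 xy]; first exact: mulr_gt0.
pose z i j := (C * expR (- (e / 2) * `|i%:~R - j%:~R|))%:E * x j.
have z0 i j : 0 <= z i j by rewrite mule_ge0 // lee_fin mulr_ge0 ?expR_ge0 // ltW.
rewrite EFinM -muleA.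
apply: (@le_trans _ _ (B%:E * lnorm r (fun i => lnorm r (z i)))); last first.
  by rewrite lee_wpmul2l ?hA // lee_fin ltW.
rewrite -lnormZ // => [|n]; last exact: lnorm_ge0.
apply: lnorm_le => // [n|i]; first exact: lnorm_ge0.
apply: (@le_trans _ _ (lnorm q (fun j =>
    lnorm r (z i) * (expR (- (e / 2) * `|j%:~R - i%:~R|))%:E))).
  apply: lnorm_le => // j; apply: (le_trans (xy i j)).
  apply: (@le_trans _ _ (z i j * (expR (- (e / 2) * `|j%:~R - i%:~R|))%:E)).
    rewrite /z muleAC -EFinM -mulrA -expRD (distrC j%:~R) -mulrDl -opprD.
    by rewrite -splitr.
  by rewrite lee_wpmul2r ?lee_fin ?expR_ge0 //; exact: le_lnorm.
refine (le_trans (lnormZ_le _ _ _) _) => //; first exact: lnorm_ge0.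
by rewrite muleC lee_wpmul2r ?lnorm_ge0.
Qed.

End GeometricKernels.

(** * Step functions on exponential blocks and their integrals *)

Section StepFunctions.
Local Open Scope ereal_scope.
Context {R : realType}.
Local Notation mu := (@completed_lebesgue_measure R).
Implicit Types (c x : int -> \bar R) (m : int) (q : \bar R).

Definition unit_block (m : int) : set R :=
  `[expR m%:~R, expR (m%:~R + 1)[%classic.

Lemma unit_blockP m (s : R) :
  unit_block m s <-> (0 < s)%R /\ Num.floor (ln s) = m.
Proof.
rewrite /unit_block /= in_itv /=; split.
  move=> /andP[ms sm]; have s0 : (0 < s)%R := lt_le_trans (expR_gt0 _) ms.
  split => //; apply: floor_def; rewrite intrD.
  by rewrite -[s]lnK ?posrE // ler_expR ltr_expR in ms sm; rewrite ms sm.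
move=> [s0 <-]; have := floor_le (ln s); have := floorD1_gt (ln s).
by rewrite intrD -ltr_expR -(ler_expR _ (ln s)) lnK ?posrE // => -> ->.
Qed.

Lemma measurable_unit_block m : measurable (unit_block m : set (lebesgueType R)).
Proof. by apply: sub_caratheodory; exact: measurable_itv. Qed.

Lemma measure_unit_block m :
  mu (unit_block m) = (expR m%:~R * (expR 1 - 1))%:E.
Proof.
rewrite -[LHS]/(lebesgue_measure (unit_block m : set R)) /unit_block.
rewrite lebesgue_measure_itv /= lte_fin ltr_expR ltrDl ltr01 -EFinB.
by rewrite expRD mulrBr mulr1.
Qed.

(** Transports sums over [int] to series over [nat], the form in which sum and integral are
    exchanged. *)
Lemma int_enum : exists e : nat -> int, set_bij [set: nat] [set: int] e.
Proof.
exists (fun k => if odd k then Negz k./2 else Posz k./2); split => //.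
  move=> i j _ _ /= ij; rewrite -(odd_double_half i) -(odd_double_half j).
  by move: ij; case: (odd i); case: (odd j) => // -[->].
move=> [n|n] _ /=; [exists n.*2 => //|exists n.*2.+1 => //].
  by rewrite odd_double doubleK.
by rewrite /= odd_double /= uphalf_double.
Qed.

(** A sum of indicators rather than a value at [Num.floor (ln s)], so that it can be integrated term
    by term; it vanishes for [s <= 0]. *)
Definition step_fun c (s : R) : \bar R :=
  \esum_(m in setT) (c m * (\1_(unit_block m) s)%:E).

Lemma step_funE c m s : (forall m, 0 <= c m) -> unit_block m s ->
  step_fun c s = c m.
Proof.
move=> c0 ms; rewrite /step_fun (esumID [set m]) => [|i _]; last first.
  by rewrite mule_ge0 // lee_fin.
rewrite setTI setTI [X in _ + X]esum1 ?adde0; last first.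
  move=> i /= im; rewrite indicE memNset ?mule0 // => /unit_blockP[_ fi].
  by apply: im; rewrite -fi; case/unit_blockP: ms.
by rewrite esum_set1 ?indicE ?mem_set ?mule1.
Qed.

Lemma step_fun_npos c (s : R) : (s <= 0)%R -> step_fun c s = 0.
Proof.
move=> s0; rewrite /step_fun esum1 // => i _.
rewrite indicE memNset ?mule0 // => /unit_blockP[+ _].
by rewrite ltNge s0.
Qed.

Lemma integral_step_fun c : (forall m, 0 <= c m) ->
  \int[mu]_s step_fun c s =
  \esum_(m in setT) (c m * (expR m%:~R * (expR 1 - 1))%:E).
Proof.
move=> c0; have [e eb] := int_enum.
have E1 : 0 <= (expR 1 - 1 : R)%:E by rewrite lee_fin subr_ge0 -expR0 ler_expR.
have cge m (t : R) : (0 <= t)%R -> 0 <= c m * t%:E by move=> t0; rewrite mule_ge0.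
transitivity (\int[mu]_s
    \sum_(k <oo) (c (e k) * (\1_(unit_block (e k)) s)%:E)).
  apply: eq_integral => s _; rewrite /step_fun (@reindex_esum _ _ _ _ _ _ _ eb).
  by rewrite nneseries_esumT // => k; apply: cge.
rewrite integral_nneseries; [|exact: measurableT| |]; last 2 first.
- move=> k; apply: measurable_funeM; apply/measurable_EFinP.
  by apply: measurable_indic; exact: measurable_unit_block.
- by move=> k s _; apply: cge.
rewrite [RHS](@reindex_esum _ _ _ _ _ _ _ eb) -nneseries_esumT; last first.
  by move=> k; rewrite mule_ge0 // EFinM mule_ge0 // lee_fin expR_ge0.
apply: eq_eseriesr => k _.
rewrite ge0_integralZl; [|exact: measurableT| |by []|exact: c0]; last first.
- by apply/measurable_EFinP; apply: measurable_indic; exact: measurable_unit_block.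
rewrite integral_indic //; last exact: measurable_unit_block.
by rewrite setIT; congr (_ * _); exact: measure_unit_block.
Qed.

(** The integral of a nonnegative function is a supremum over the simple functions below it, and
    this set grows with the function. No measurability of the integrands built from the K-functional
    is therefore at stake. *)
Lemma le_integral_nonmeasurable (f g : lebesgueType R -> \bar R) :
  (forall s, 0 <= f s) -> (forall s, f s <= g s) ->
  \int[mu]_s f s <= \int[mu]_s g s.
Proof.
move=> f0 fg; have g0 s : 0 <= g s := le_trans (f0 s) (fg s).
rewrite !ge0_integralTE //; apply: ereal_sup_le => _ [h hf <-].
by exists h => // s; exact: le_trans (hf s) (fg s).
Qed.

End StepFunctions.

(** * Lebesgue quasi-norms against sequence quasi-norms *)

Section Discretization.
Local Open Scope ereal_scope.
Context {R : realType}.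
Local Notation mu := (@completed_lebesgue_measure R).
Implicit Types (x : int -> \bar R) (m : int) (q : \bar R).

Lemma rinv_EFin (p : R) : (0 < p)%R -> rinv p%:E = p^-1%R.
Proof. by move=> p0; rewrite /rinv inver gt_eqF. Qed.

Lemma measure_unit_block_gt0 m : 0 < mu (unit_block m).
Proof.
have E1 : (0 < expR 1 - 1 :> R)%R by rewrite subr_gt0 expR_gt1.
by rewrite measure_unit_block lte_fin mulr_gt0 ?expR_gt0.
Qed.

Lemma measure_line_gt0 : 0 < mu [set: lebesgueType R].
Proof.
apply: lt_le_trans (measure_unit_block_gt0 0) _.
by apply: le_measure; rewrite ?inE //; exact: measurable_unit_block.
Qed.

Let block_weight_ge0 p x m : 0 <= (expR (- m%:~R))%:E * x m `^ p.
Proof. by rewrite mule_ge0 ?poweR_ge0 // lee_fin expR_ge0. Qed.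

(** The factor [expR (- m%:~R)] cancels the length of block [m] up to the constant [expR 1 - 1]. *)
Let esum_block p x : (0 < p)%R -> (forall m, 0 <= x m) ->
  \int[mu]_s step_fun (fun m => (expR (- m%:~R))%:E * x m `^ p) s =
  (expR 1 - 1)%:E * lnorm p%:E x `^ p.
Proof.
move=> p0 x0; rewrite integral_step_fun // lnorm_pow //.
have E1 : (0 < expR 1 - 1 :> R)%R by rewrite subr_gt0 expR_gt1.
transitivity (\esum_(m in setT) ((expR 1 - 1)%:E * x m `^ p)).
  apply: eq_esum => m _.
  by rewrite muleAC -EFinM mulrA -expRD addNr expR0 mul1r.
apply/eqP; rewrite eq_le le_esumZl ?lee_fin ?(ltW E1) //=; last first.
  by move=> m; rewrite poweR_ge0.
rewrite -lee_pdivlMl //.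
refine (le_trans _ (le_esumZl _ _)); rewrite ?lee_fin ?invr_ge0 ?(ltW E1) //.
  by apply: le_esum => m _; rewrite muleA -EFinM mulVf ?gt_eqF // mul1e.
by move=> m; rewrite mule_ge0 ?poweR_ge0 // lee_fin ltW.
Qed.

(** On block [m] the factor s^(-1/q) of the norms has size [expR (- rinv q * m%:~R)]; [x m] stands
    for what remains. *)
Lemma Lq_le_lnorm q : 0 < q -> exists2 A : R, (0 < A)%R &
  forall (D : set R) (F : R -> \bar R) x, (forall m, 0 <= x m) ->
  (forall s, D s -> (0 < s)%R) -> (forall s, D s -> 0 <= F s) ->
  (forall m s, unit_block m s -> D s ->
    F s <= (expR (- rinv q * m%:~R))%:E * x m) ->
  Lq q D F <= A%:E * lnorm q x.
Proof.
case: q => [p| |] //; rewrite ?lte_fin => p0; last first.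
  exists 1%R => // D F x x0 D0 F0 Fx; rewrite mul1e /Lq unlock measure_line_gt0.
  apply/ess_supP; apply: aeW => s /=.
  rewrite /patch; case: ifPn => [|_]; last by rewrite abse0; exact: (@lnorm_ge0 _ +oo%E).
  rewrite inE => Ds; rewrite gee0_abs ?F0 //.
  have ms : unit_block (Num.floor (ln s)) s by apply/unit_blockP; split => //; exact: D0.
  apply: le_trans (Fx _ _ ms Ds) _.
  rewrite /rinv invey /= oppr0 mul0r expR0 mul1e.
  exact: (@le_lnorm _ +oo%E).
have E1 : (0 < expR 1 - 1 :> R)%R by rewrite subr_gt0 expR_gt1.
exists ((expR 1 - 1) `^ p^-1)%R; first by rewrite powR_gt0.
move=> D F x x0 D0 F0 Fx.
have X0 := lnorm_ge0 p%:E x0.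
apply: (@poweR_leP _ p) => //; first by rewrite /Lq Lnorm_ge0.
  by rewrite mule_ge0 // lee_fin powR_ge0.
rewrite poweRM ?lee_fin ?powR_ge0 // poweR_EFin -powRrM mulVf ?gt_eqF //.
rewrite powRr1 ?(ltW E1) // /Lq powR_Lnorm ?gt_eqF // -esum_block //.
apply: le_integral_nonmeasurable => s; first exact: poweR_ge0.
rewrite /patch; case: ifPn => [|_]; last first.
  rewrite abse0 poweR0r ?gt_eqF //.
  by apply: esum_ge0 => m _; rewrite mule_ge0 // lee_fin.
rewrite inE => Ds.
have ms : unit_block (Num.floor (ln s)) s by apply/unit_blockP; split => //; exact: D0.
rewrite (step_funE _ ms) // gee0_abs ?F0 //.
apply: (le_trans (poweR_le (ltW p0) (F0 _ Ds) (Fx _ _ ms Ds))).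
rewrite poweRM ?lee_fin ?expR_ge0 // poweR_EFin rinv_EFin // -expRM.
by rewrite mulrAC mulNr mulVf ?gt_eqF // mulN1r.
Qed.

(** No constant is lost because [expR 1 - 1] is at least 1. Asking for the lower bound only where
    [x m] is positive lets [x] be a sequence cut to the blocks contained in [D]. *)
Lemma lnorm_le_Lq q (D : set R) (F : R -> \bar R) x :
  0 < q -> (forall m, 0 <= x m) ->
  (forall m s, unit_block m s -> 0 < x m ->
    D s /\ (expR (- rinv q * m%:~R))%:E * x m <= F s) ->
  lnorm q x <= Lq q D F.
Proof.
case: q => [p| |] //; rewrite ?lte_fin => p0 x0 xF; last first.
  apply: ge_ereal_sup => _ [m _ <-].
  have /orP[/eqP<-|xm] : (0 == x m) || (0 < x m) by rewrite -le_eqVlt.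
    by rewrite /Lq Lnorm_ge0.
  rewrite /Lq unlock measure_line_gt0.
  set g := abse \o _; have [N [mN N0 sN]] := ess_sup_ge mu g.
  (* If the essential supremum were below [x m], the whole block [m], of positive measure, would lie
     in the null set [N]. *)
  apply: contrapT => /negP; rewrite -ltNge => hlt.
  have : mu (unit_block m) <= mu N.
    apply: le_measure; rewrite ?inE //; first exact: measurable_unit_block.
    move=> s ms; apply: sN => /= hs.
    have [Ds] := xF m s ms xm.
    rewrite /rinv invey /= oppr0 mul0r expR0 mul1e => xs.
    have := lt_le_trans hlt xs; apply/negP; rewrite -leNgt.
    by apply: le_trans hs; rewrite /g /patch /= mem_set // lee_abs.
  by rewrite N0 leNgt measure_unit_block_gt0.
have X0 := lnorm_ge0 p%:E x0.
apply: (@poweR_leP _ p) => //; first by rewrite /Lq Lnorm_ge0.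
apply: (@le_trans _ _ ((expR 1 - 1)%:E * lnorm p%:E x `^ p)).
  rewrite lee_pemull ?poweR_ge0 // lee_fin lerBrDr.
  by have := expR_ge1Dx (1 : R).
rewrite -esum_block // /Lq powR_Lnorm ?gt_eqF //.
apply: le_integral_nonmeasurable => s.
  by apply: esum_ge0 => m _; rewrite mule_ge0 // lee_fin.
have [s0|s0] := leP s 0%R; first by rewrite step_fun_npos // poweR_ge0.
have ms : unit_block (Num.floor (ln s)) s by apply/unit_blockP.
rewrite (step_funE _ ms) //.
set m := Num.floor (ln s).
have /orP[/eqP<-|xm] : (0 == x m) || (0 < x m) by rewrite -le_eqVlt.
  by rewrite poweR0r ?gt_eqF // mule0 poweR_ge0.
have [Ds xs] := xF _ s ms xm.
rewrite /patch mem_set //.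
apply: (@le_trans _ _ (((expR (- rinv p%:E * m%:~R))%:E * x m) `^ p)).
  rewrite poweRM ?lee_fin ?expR_ge0 // poweR_EFin rinv_EFin // -expRM.
  by rewrite mulrAC mulNr mulVf ?gt_eqF // mulN1r.
apply: poweR_le => //; first exact: ltW.
  by rewrite mule_ge0 // lee_fin expR_ge0.
exact: le_trans (lee_abs _).
Qed.

End Discretization.

Section BlockComparison.
Local Open Scope ereal_scope.
Context {R : realType}.
Implicit Types (x : int -> \bar R) (m : int) (q : \bar R).

Lemma rinv_ge0 q : 0 < q -> (0 <= rinv q)%R.
Proof.
case: q => [p| |] //; rewrite ?lte_fin => p0.
by rewrite rinv_EFin // invr_ge0 ltW.
Qed.

Lemma unit_block_ln m (s : R) : unit_block m s ->
  [/\ (0 < s)%R, (m%:~R <= ln s)%R & (ln s < m%:~R + 1)%R].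
Proof.
move=> /unit_blockP[s0 <-]; split => //; first exact: floor_le.
by have := floorD1_gt (ln s); rewrite intrD.
Qed.

Lemma Lq_blocks_le q (C : R) : 0 < q -> (0 < C)%R ->
  exists2 A : R, (0 < A)%R &
  forall (D : set R) (F g : R -> \bar R) x, (forall m, 0 <= x m) ->
  (forall s, D s -> (0 < s)%R) -> (forall s, 0 <= g s) ->
  (forall s, (0 < s)%R -> F s = (s `^ (- rinv q))%:E * g s) ->
  (forall m s, unit_block m s -> D s -> g s <= C%:E * x m) ->
  Lq q D F <= A%:E * lnorm q x.
Proof.
move=> q0 C0; have [A A0 hA] := Lq_le_lnorm q0.
exists (A * C)%R => [|D F g x x0 D0 g0 Fg gx]; first exact: mulr_gt0.
have Cx m : 0 <= C%:E * x m by rewrite mule_ge0 // lee_fin ltW.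
rewrite EFinM -muleA -lnormZ //; apply: hA => // [s Ds|m s ms Ds].
  by rewrite Fg ?D0 // mule_ge0 // lee_fin powR_ge0.
rewrite Fg ?D0 // lee_pmul ?gx // lee_fin ?powR_ge0 //.
rewrite /powR gt_eqF ?D0 // ler_expR.
have [_ mln _] := unit_block_ln ms.
by rewrite !mulNr lerN2 ler_wpM2l // rinv_ge0.
Qed.

Lemma Lq_blocks_ge q (C : R) : 0 < q -> (0 < C)%R ->
  exists2 A : R, (0 < A)%R &
  forall (D : set R) (F g : R -> \bar R) x, (forall m, 0 <= x m) ->
  (forall s, 0 <= g s) ->
  (forall s, (0 < s)%R -> F s = (s `^ (- rinv q))%:E * g s) ->
  (forall m s, unit_block m s -> 0 < x m -> D s /\ x m <= C%:E * g s) ->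
  lnorm q x <= A%:E * Lq q D F.
Proof.
(* On a block s^(-1/q) drops at most by the factor [expR (- rinv q)], since [ln s] varies by less
   than 1. *)
move=> q0 C0; set B := (C * expR (rinv q))%R.
have B0 : (0 < B)%R by rewrite mulr_gt0 ?expR_gt0.
exists B => // D F g x x0 g0 Fg xg.
rewrite -lee_pdivrMl // -lnormZ // ?invr_gt0 //.
have Bx m : 0 <= (B^-1)%:E * x m by rewrite mule_ge0 // lee_fin invr_ge0 ltW.
apply: lnorm_le_Lq => // m s ms Bxm.
have xm : 0 < x m by rewrite pmule_rgt0 ?lte_fin ?invr_gt0 in Bxm.
have [Ds xgs] := xg m s ms xm; split => //.
have [s0 mln lnm] := unit_block_ln ms.
rewrite Fg // muleCA lee_pdivrMl // muleA -EFinM.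
apply: (@le_trans _ _ ((expR (- rinv q * m%:~R))%:E * (C%:E * g s))).
  by rewrite lee_wpmul2l // lee_fin expR_ge0.
rewrite muleA -EFinM lee_wpmul2r // lee_fin /B -mulrA mulrC.
rewrite ler_wpM2l ?(ltW C0) // /powR gt_eqF // -expRD ler_expR.
have := rinv_ge0 q0; nra.
Qed.

End BlockComparison.

(** * Regularly varying weights in the logarithmic variable *)

Section RegularVariation.
Context {R : realType}.
Local Open Scope ring_scope.
Implicit Types (al be e : R) (g h : R -> R).

(* In the logarithmic variable: [g] is [expR (al * x)] times a slowly varying
   function. *)
Definition regular al g : Prop :=
  (forall x, 0 < g x) /\
  forall e, 0 < e -> exists2 C : R, 0 < C & forall x y,
    g x <= C * expR (al * (x - y) + e * `|x - y|) * g y.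

Lemma regular_exp al : regular al (fun x => expR (al * x)).
Proof.
split=> [x|e e0]; first exact: expR_gt0.
exists 1 => // x y; rewrite mul1r -expRD ler_expR mulrBr.
have : 0 <= e * `|x - y| by rewrite mulr_ge0 // ltW.
lra.
Qed.

Lemma regularM al be g h : regular al g -> regular be h ->
  regular (al + be) (fun x => g x * h x).
Proof.
move=> [g0 hg] [h0 hh]; split=> [x|e e0]; first exact: mulr_gt0.
have e20 : 0 < e / 2 by rewrite divr_gt0.
have [C C0 hC] := hg _ e20; have [D D0 hD] := hh _ e20.
exists (C * D) => [|x y]; first exact: mulr_gt0.
apply: (le_trans (ler_pM (ltW (g0 x)) (ltW (h0 x)) (hC x y) (hD x y))).
rewrite mulrACA ler_wpM2r //; first by rewrite mulr_ge0 // ltW.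
rewrite mulrACA ler_wpM2l //; first by rewrite mulr_ge0 // ltW.
by rewrite -expRD ler_expR; lra.
Qed.

Lemma regularV al g : regular al g -> regular (- al) (fun x => (g x)^-1).
Proof.
move=> [g0 hg]; split=> [x|e e0]; first by rewrite invr_gt0.
have [C C0 hC] := hg _ e0; exists C => // x y.
rewrite -[X in X <= _]div1r ler_pdivrMr // mulrAC ler_pdivlMr // mul1r.
apply: (le_trans (hC y x)); rewrite ler_wpM2r ?(ltW (g0 x)) //.
by rewrite ler_wpM2l ?(ltW C0) // ler_expR distrC; lra.
Qed.

Lemma regular_powR al th g : 0 <= th -> regular al g ->
  regular (th * al) (fun x => g x `^ th).
Proof.
move=> th0 [g0 hg]; split=> [x|e e0]; first by rewrite powR_gt0.
have th10 : 0 < th + 1 by rewrite ltr_wpDl.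
(* Dividing by [th + 1] instead of [th] includes the case [th = 0]. *)
have [C C0 hC] := hg (e / (th + 1)) (divr_gt0 e0 th10).
exists (C `^ th) => [|x y]; first by rewrite powR_gt0.
apply: (@le_trans _ _ ((C * expR (al * (x - y) + e / (th + 1) * `|x - y|) * g y) `^ th)).
  apply: ge0_ler_powR => //; rewrite ?nnegrE ?(ltW (g0 x)) ?mulr_ge0 ?expR_ge0 //; exact: ltW.
rewrite !powRM ?mulr_ge0 ?expR_ge0 ?(ltW C0) ?(ltW (g0 y)) //.
rewrite ler_wpM2r ?powR_ge0 // ler_wpM2l ?powR_ge0 // -expRM ler_expR.
set u := e / (th + 1).
have k : u * th <= e by rewrite /u mulrAC ler_pdivrMr // ler_pM2l // lerDl.
by have := ler_wpM2r (normr_ge0 (x - y)) k; lra.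
Qed.

(** For [x <= y] the increasing equivalent of t^e b(t) is used, otherwise the decreasing equivalent
    of t^(-e) b(t). Passing to the monotone function and back costs its constant twice, whence the
    squares. *)
Lemma regular_slowly_varying (b : R -> R) : slowly_varying b ->
  regular 0 (fun x => b (expR x)).
Proof.
move=> [b0 _ hb]; split=> [x|e e0]; first by rewrite b0 // expR_gt0.
have [[g [g0 gmono [C hC]]] [h [h0 hmono [D hD]]]] := hb e e0.
have bp x : 0 < b (expR x) by rewrite b0 ?expR_gt0.
have C0 : 0 < C.
  have [+ _] := hC 1 ltr01; rewrite powR1 mul1r => b1.
  by have := lt_le_trans (b0 1 ltr01) b1; rewrite pmulr_lgt0 // g0.
have D0 : 0 < D.
  have [+ _] := hD 1 ltr01; rewrite powR1 mul1r => b1.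
  by have := lt_le_trans (b0 1 ltr01) b1; rewrite pmulr_lgt0 // h0.
exists (C ^+ 2 + D ^+ 2) => [|x y]; first by rewrite addr_gt0 // exprn_gt0.
rewrite mul0r add0r.
have main (B s : R) : 0 < B -> B <= C ^+ 2 + D ^+ 2 -> s * (y - x) = e * `|x - y| ->
    expR (s * x) * b (expR x) <= B * (expR (s * y) * b (expR y)) ->
    b (expR x) <= (C ^+ 2 + D ^+ 2) * expR (e * `|x - y|) * b (expR y).
  move=> B0 BCD <- hB; apply: (@le_trans _ _ (B * expR (s * (y - x)) * b (expR y))).
    have sE : expR (s * y) = expR (s * x) * expR (s * (y - x)).
      by rewrite -expRD; congr expR; ring.
    rewrite -(ler_pM2l (expR_gt0 (s * x))) (le_trans hB) // sE.
    by rewrite le_eqVlt; apply/orP; left; apply/eqP; ring.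
  by rewrite ler_wpM2r ?(ltW (bp y)) // ler_wpM2r ?expR_ge0.
have [xy|yx] := leP x y.
  apply: (main (C ^+ 2) e); rewrite ?exprn_gt0 ?lerDl ?sqr_ge0 //.
    by rewrite distrC ger0_norm // subr_ge0.
  have [+ _] := hC _ (expR_gt0 x); have [_ +] := hC _ (expR_gt0 y).
  rewrite -!expRM ![_ * e]mulrC => hy hx; apply: (le_trans hx).
  rewrite expr2 -mulrA ler_pM2l //; apply: le_trans hy.
  by apply: gmono; rewrite ?expR_gt0 ?ler_expR.
apply: (main (D ^+ 2) (- e)); rewrite ?exprn_gt0 ?lerDr ?sqr_ge0 //.
  by rewrite ger0_norm ?subr_ge0 ?(ltW yx) //; lra.
have [+ _] := hD _ (expR_gt0 x); have [_ +] := hD _ (expR_gt0 y).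
rewrite -!expRM ![_ * - e]mulrC => hy hx; apply: (le_trans hx).
rewrite expr2 -mulrA ler_pM2l //; apply: le_trans hy.
by apply: hmono; rewrite ?expR_gt0 ?ler_expR ?(ltW yx).
Qed.

(** In logarithms a regularly varying function is Lipschitz at large scale. This controls both
    compositions and the gaps between consecutive points ln rho_n. *)
Lemma regular_ln al g : regular al g -> exists2 C : R, 0 < C &
  forall x y, `|ln (g x) - ln (g y)| <= C + (`|al| + 1) * `|x - y|.
Proof.
move=> [g0 hg]; have [C C0 hC] := hg 1 ltr01.
have lnC x y : ln (g x) - ln (g y) <= ln C + (`|al| + 1) * `|x - y|.
  rewrite lerBlDr -ler_expR !expRD !lnK ?posrE //.
  apply: (le_trans (hC x y)); rewrite ler_wpM2r ?(ltW (g0 y)) //.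
  rewrite ler_wpM2l ?(ltW C0) // ler_expR mulrDl lerD2r.
  by rewrite -normrM ler_norm.
exists (`|ln C| + 1) => [|x y]; first by rewrite ltr_wpDl.
have := lnC x y; have := lnC y x; have := ler_norm (ln C).
rewrite (distrC y x) ler_norml => h1 h2 h3; apply/andP; split; lra.
Qed.

(** By [regular_ln], distances in the argument of [a] grow at most by the factor [|al| + 1] and an
    additive constant; the first is absorbed by shrinking [e], the second by enlarging [C]. This
    makes a(rho(t)) slowly varying. *)
Lemma regular_comp al (a g : R -> R) : slowly_varying a -> regular al g ->
  regular 0 (fun x => a (g x)).
Proof.
move=> /regular_slowly_varying[a0 ha] rg; have [g0 _] := rg.
have aE x : a (g x) = a (expR (ln (g x))) by rewrite lnK ?posrE.
split=> [x|e e0]; first by rewrite aE.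
have [D D0 hD] := regular_ln rg.
have k0 : 0 < `|al| + 1 by rewrite ltr_wpDl.
have d0 : 0 < e / (`|al| + 1) by rewrite divr_gt0.
have [C C0 hC] := ha _ d0.
exists (C * expR (e / (`|al| + 1) * D)) => [|x y]; first by rewrite mulr_gt0 ?expR_gt0.
rewrite !aE; apply: (le_trans (hC _ (ln (g y)))).
rewrite ler_wpM2r ?(ltW (a0 _)) // -[leRHS]mulrA ler_wpM2l ?(ltW C0) //.
rewrite -expRD ler_expR !mul0r !add0r.
have := ler_wpM2l (ltW d0) (hD x y); rewrite mulrDr mulrA divfK ?gt_eqF //.
Qed.

End RegularVariation.

(** * Norms over half-lines and their cut sequences *)

Section WeightedBlocks.
Local Open Scope ereal_scope.
Context {R : realType}.
Implicit Types (x : int -> \bar R) (m : int) (q : \bar R) (g F : R -> \bar R) (S T : pred int).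

Definition seqcut (S : pred int) x m : \bar R := if S m then x m else 0.

Lemma seqcut_ge0 S x : (forall m, 0 <= x m) -> forall m, 0 <= seqcut S x m.
Proof. by move=> x0 m; rewrite /seqcut; case: ifP. Qed.

(** Needed because the endpoint of an interval may fall inside a block: the blocks meeting the
    interval and those contained in it differ near the endpoint only. *)
Lemma lnorm_cut_near q (C : R) : 0 < q -> (0 < C)%R ->
  exists2 A : R, (0 < A)%R & forall x (S T : pred int), (forall m, 0 <= x m) ->
  (forall i j : int, (`|i - j| <= 1)%R -> x i <= C%:E * x j) ->
  (forall i, S i -> exists2 j, T j & (`|i - j| <= 1)%R) ->
  lnorm q (seqcut S x) <= A%:E * lnorm q (seqcut T x).
Proof.
move=> q0 C0; have CC0 : (0 < C * expR 1)%R by rewrite mulr_gt0 ?expR_gt0.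
have [A A0 hA] := @lnorm_dom R q 1%R _ q0 ltr01 CC0.
exists A => // x S T x0 xx ST; apply: hA; try exact: seqcut_ge0.
move=> i; case: (boolP (S i)) => [Si|nSi]; last first.
  exists i; rewrite {1}/seqcut (negbTE nSi) mule_ge0 ?seqcut_ge0 //.
  by rewrite lee_fin !mulr_ge0 ?expR_ge0 // ltW.
have [j Tj ij] := ST i Si; exists j; rewrite /seqcut Si Tj.
apply: (le_trans (xx i j ij)); rewrite lee_wpmul2r // lee_fin.
rewrite -mulrA -expRD ler_pMr // -[leLHS]expR0 ler_expR.
have : (`|i%:~R - j%:~R| <= 1 :> R)%R by rewrite -rmorphB /= -intr_norm -[leRHS]/(1%:~R) ler_int.
lra.
Qed.

Definition unit_regular (C : R) g : Prop :=
  forall x y : R, (`|x - y| <= 1)%R -> g x <= C%:E * g y.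

Let line_dist (x : R) (m : int) :
  (m%:~R <= x)%R -> (x < m%:~R + 1)%R -> (`|x - m%:~R| <= 1)%R.
Proof. by move=> h1 h2; rewrite ger0_norm; lra. Qed.

Variables (q : \bar R) (C : R).
Hypotheses (q0 : 0 < q) (C0 : (0 < C)%R).

Lemma Lq_line : exists2 A : R, (0 < A)%R & forall F g, (forall u, 0 <= g u) ->
  unit_regular C g ->
  (forall s, (0 < s)%R -> F s = (s `^ (- rinv q))%:E * g (ln s)) ->
  Lq q `]0%R, +oo[%classic F <= A%:E * lnorm q (fun m => g m%:~R) /\
  lnorm q (fun m => g m%:~R) <= A%:E * Lq q `]0%R, +oo[%classic F.
Proof.
have [A A0 hA] := Lq_blocks_le q0 C0; have [B B0 hB] := Lq_blocks_ge q0 C0.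
exists (A + B)%R => [|F g g0 gC Fg]; first exact: addr_gt0.
split.
  apply: (@le_trans _ _ (A%:E * lnorm q (fun m => g m%:~R))); last first.
    by rewrite lee_wpmul2r ?lnorm_ge0 // lee_fin lerDl ltW.
  apply: (hA _ _ (fun s => g (ln s))) => // [s|m s ms _].
    by rewrite /= in_itv /= andbT.
  by have [_ h1 h2] := unit_block_ln ms; apply: gC; exact: line_dist.
apply: (@le_trans _ _ (B%:E * Lq q `]0%R, +oo[%classic F)); last first.
  by rewrite lee_wpmul2r ?Lnorm_ge0 // lee_fin lerDr ltW.
apply: (hB _ _ (fun s => g (ln s))) => // m s ms _.
have [s0 h1 h2] := unit_block_ln ms; split; first by rewrite /= in_itv /= s0.
by apply: gC; rewrite distrC; exact: line_dist.
Qed.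

(** [S] has to contain every block that meets the set [D y], and [T] only blocks contained in it.
    Upper bounds use [S], lower bounds use [T], and [lnorm_cut_near] closes the gap. *)
Let Lq_cut (S : R -> int -> pred int) (T : R -> int -> pred int)
    (D : R -> set R) :
  (forall y m, (m%:~R <= y)%R -> (y < m%:~R + 1)%R ->
    [/\ forall s, D y s -> (0 < s)%R,
        forall s i, unit_block i s -> D y s -> S y m i,
        forall s i, unit_block i s -> T y m i -> D y s &
        forall i, S y m i -> exists2 j, T y m j & (`|i - j| <= 1)%R]) ->
  exists2 A : R, (0 < A)%R & forall F g, (forall u, 0 <= g u) ->
  unit_regular C g ->
  (forall s, (0 < s)%R -> F s = (s `^ (- rinv q))%:E * g (ln s)) ->
  forall y m, (m%:~R <= y)%R -> (y < m%:~R + 1)%R ->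
  Lq q (D y) F <= A%:E * lnorm q (seqcut (S y m) (fun i => g i%:~R)) /\
  lnorm q (seqcut (S y m) (fun i => g i%:~R)) <= A%:E * Lq q (D y) F.
Proof.
move=> hST.
have [A A0 hA] := Lq_blocks_le q0 C0; have [B B0 hB] := Lq_blocks_ge q0 C0.
have [E E0 hE] := lnorm_cut_near q0 C0.
exists (A + E * B)%R; first by rewrite addr_gt0 // mulr_gt0.
move=> F g g0 gC Fg y m my ym; have [D0 DS TD ST] := hST y m my ym.
have gi0 i : 0 <= g i%:~R by [].
split.
  apply: (@le_trans _ _ (A%:E * lnorm q (seqcut (S y m) (fun i => g i%:~R)))); last first.
    rewrite lee_wpmul2r ?lnorm_ge0 ?lee_fin ?lerDl //; first exact: seqcut_ge0.
    by rewrite mulr_ge0 // ltW.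
  apply: (hA _ _ (fun s => g (ln s))) => //; first exact: seqcut_ge0.
  move=> i s si Ds; rewrite /seqcut (DS s i si Ds).
  by have [_ h1 h2] := unit_block_ln si; apply: gC; exact: line_dist.
apply: (@le_trans _ _ (E%:E * (B%:E * Lq q (D y) F))); last first.
  by rewrite muleA -EFinM lee_wpmul2r ?Lnorm_ge0 // lee_fin lerDr ltW.
have giC (i j : int) : (`|i - j| <= 1)%R -> g i%:~R <= C%:E * g j%:~R.
  move=> ij; apply: gC.
  by rewrite -rmorphB /= -intr_norm -[leRHS]/(1%:~R) ler_int.
apply: (le_trans (hE _ _ _ gi0 giC ST)).
rewrite lee_wpmul2l ?lee_fin ?(ltW E0) //.
apply: (hB _ _ (fun s => g (ln s))) => //; first exact: seqcut_ge0.
move=> i s si; rewrite /seqcut; case: ifP => [Ti _|_]; last by rewrite ltxx.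
split; first exact: TD si Ti.
have [_ h1 h2] := unit_block_ln si.
by apply: gC; rewrite distrC; exact: line_dist.
Qed.

Lemma Lq_below : exists2 A : R, (0 < A)%R & forall F g, (forall u, 0 <= g u) ->
  unit_regular C g ->
  (forall s, (0 < s)%R -> F s = (s `^ (- rinv q))%:E * g (ln s)) ->
  forall y m, (m%:~R <= y)%R -> (y < m%:~R + 1)%R ->
  Lq q `]0%R, expR y[%classic F <=
    A%:E * lnorm q (seqcut (fun i => i <= m)%R (fun i => g i%:~R)) /\
  lnorm q (seqcut (fun i => i <= m)%R (fun i => g i%:~R)) <=
    A%:E * Lq q `]0%R, expR y[%classic F.
Proof.
(* Block [m] contains [expR y] and so is met at most partially; the blocks before it are contained
   in the interval. *)
apply: (@Lq_cut (fun _ m i => (i <= m)%R) (fun _ m i => (i < m)%R)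
  (fun y => `]0%R, expR y[%classic)) => y m my ym; split => /=.
- by move=> s; rewrite in_itv /= => /andP[].
- move=> s i si; rewrite in_itv /= => /andP[s0 sy].
  have [_ h1 h2] := unit_block_ln si.
  have : (ln s < y)%R by rewrite -ltr_expR lnK ?posrE.
  move=> sy'; have : (i%:~R < m%:~R + 1 :> R)%R by lra.
  by rewrite -[1%R]/(1%:~R) -intrD ltr_int ltzD1.
- move=> s i si im; have [s0 h1 h2] := unit_block_ln si.
  have : ((i + 1)%:~R <= m%:~R :> R)%R by rewrite ler_int; lia.
  rewrite intrD in_itv /= s0 /= -[s]lnK ?posrE // ltr_expR; lra.
- move=> i im; exists (Num.min i (m - 1)%R); first by lia.
  by lia.
Qed.

Lemma Lq_above : exists2 A : R, (0 < A)%R & forall F g, (forall u, 0 <= g u) ->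
  unit_regular C g ->
  (forall s, (0 < s)%R -> F s = (s `^ (- rinv q))%:E * g (ln s)) ->
  forall y m, (m%:~R <= y)%R -> (y < m%:~R + 1)%R ->
  Lq q `]expR y, +oo[%classic F <=
    A%:E * lnorm q (seqcut (fun i => m <= i)%R (fun i => g i%:~R)) /\
  lnorm q (seqcut (fun i => m <= i)%R (fun i => g i%:~R)) <=
    A%:E * Lq q `]expR y, +oo[%classic F.
Proof.
apply: (@Lq_cut (fun _ m i => (m <= i)%R) (fun _ m i => (m < i)%R)
  (fun y => `]expR y, +oo[%classic)) => y m my ym; split => /=.
- by move=> s; rewrite in_itv /= andbT; apply: lt_trans; exact: expR_gt0.
- move=> s i si; rewrite in_itv /= andbT => sy.
  have [s0 h1 h2] := unit_block_ln si.
  have : (y < ln s)%R by rewrite -ltr_expR lnK ?posrE.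
  move=> sy'; have : (m%:~R < i%:~R + 1 :> R)%R by lra.
  by rewrite -[1%R]/(1%:~R) -intrD ltr_int ltzD1.
- move=> s i si im; have [s0 h1 h2] := unit_block_ln si.
  have : ((m + 1)%:~R <= i%:~R :> R)%R by rewrite ler_int; lia.
  rewrite intrD in_itv /= andbT -[s]lnK ?posrE // ltr_expR; lra.
- move=> i im; exists (Num.max i (m + 1)%R); first by lia.
  by lia.
Qed.

End WeightedBlocks.

(** * Discretized norms of the interpolation spaces *)

Section DiscreteNorms.
Local Open Scope ereal_scope.
Context {R : realType}.
Implicit Types (q r : \bar R) (W : R -> R) (kappa : R -> \bar R).

Lemma lee_pmul_scaled (w v C c : R) (k l : \bar R) : (0 <= w)%R -> 0 <= k ->
  (w <= C * v)%R -> k <= c%:E * l -> w%:E * k <= (C * c)%:E * (v%:E * l).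
Proof.
move=> w0 k0 wv kl; rewrite EFinM muleACA -[C%:E * _]EFinM.
by apply: lee_pmul; rewrite // lee_fin.
Qed.

(* The functions [x |-> K(expR x, f)] have this property. *)
Definition quasiconcave kappa : Prop :=
  [/\ forall x, 0 <= kappa x,
      forall x y, (x <= y)%R -> kappa x <= kappa y &
      forall x y, (x <= y)%R -> kappa y <= (expR (y - x))%:E * kappa x].

(** K(t) increases and K(t)/t decreases because each single decomposition has these properties. Only
    nonnegativity of the two norms enters, so the lemma serves the couple of interpolation spaces as
    well as the original one. *)
Lemma Kfun_quasiconcave (V : nmodType) (X0 X1 : qspace R V) f :
  (forall g, X0 g -> 0 <= qnorm X0 g) -> (forall g, X1 g -> 0 <= qnorm X1 g) ->
  quasiconcave (fun x => Kfun X0 X1 (expR x) f).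
Proof.
move=> X00 X10; split => [x|x y xy|x y xy].
- apply: le_ereal_inf_tmp => _ [f0 [f1 [X0f X1f _ ->]]].
  by rewrite adde_ge0 ?X00 // mule_ge0 ?X10 // lee_fin expR_ge0.
- apply: le_ereal_inf_tmp => _ [f0 [f1 [X0f X1f ff ->]]].
  apply: (@le_trans _ _ (qnorm X0 f0 + (expR x)%:E * qnorm X1 f1)).
    by apply: ereal_inf_lbound; exists f0, f1.
  by rewrite leeD2l // lee_wpmul2r ?X10 // lee_fin ler_expR.
- rewrite -lee_pdivrMl ?expR_gt0 // -expRN opprB.
  apply: le_ereal_inf_tmp => _ [f0 [f1 [X0f X1f ff ->]]].
  apply: (@le_trans _ _ ((expR (x - y))%:E *
      (qnorm X0 f0 + (expR y)%:E * qnorm X1 f1))).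
    rewrite lee_wpmul2l ?lee_fin ?expR_ge0 //.
    by apply: ereal_inf_lbound; exists f0, f1.
  rewrite ge0_muleDr ?X00 ?mule_ge0 ?X10 ?lee_fin ?expR_ge0 //.
  rewrite muleA -EFinM -expRD subrK leeD2r // -[leRHS]mul1e.
  rewrite lee_wpmul2r ?X00 // lee_fin -expR0 ler_expR; lra.
Qed.

Lemma quasiconcave_exp kappa : quasiconcave kappa -> forall x y,
  kappa x <= (expR `|x - y|)%:E * kappa y.
Proof.
move=> [k0 kmono kexp] x y; have [xy|/ltW yx] := leP x y.
  apply: (le_trans (kmono _ _ xy)); rewrite -[leLHS]mul1e.
  by rewrite lee_wpmul2r // lee_fin -expR0 ler_expR.
apply: (le_trans (kexp _ _ yx)); rewrite lee_wpmul2r // lee_fin ler_expR.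
exact: ler_norm.
Qed.

Lemma regular_near al W : regular al W -> exists2 C : R, (0 < C)%R &
  forall x y, (`|x - y| <= 1 -> W x <= C * W y)%R.
Proof.
move=> [W0 hW]; have [C C0 hC] := hW 1%R ltr01.
exists (C * expR (`|al| + 1))%R => [|x y xy]; first by rewrite mulr_gt0 ?expR_gt0.
apply: (le_trans (hC x y)); rewrite ler_wpM2r ?(ltW (W0 y)) //.
rewrite ler_wpM2l ?(ltW C0) // ler_expR mul1r lerD //.
apply: (le_trans (ler_norm _)); rewrite normrM; have := normr_ge0 al; nra.
Qed.

Lemma weighted_unit_regular al W : regular al W -> exists2 C : R, (0 < C)%R &
  forall kappa, quasiconcave kappa ->
  unit_regular C (fun x => (W x)%:E * kappa x).
Proof.
move=> rW; have [C C0 hC] := regular_near rW; have [W0 _] := rW.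
exists (C * expR 1)%R => [|kappa qk x y xy]; first by rewrite mulr_gt0 ?expR_gt0.
have [k0 _ _] := qk; apply: lee_pmul_scaled => //; first exact: ltW (W0 x).
  exact: hC.
apply: (le_trans (quasiconcave_exp qk x y)).
by rewrite lee_wpmul2r // lee_fin ler_expR.
Qed.

Lemma regular_interp_weight al (b : R -> R) th : regular al (b \o expR) ->
  regular (- th + al) (fun x => expR (- th * x) * b (expR x))%R.
Proof. by move=> rb; apply: (regularM (regular_exp (- th)) rb). Qed.

(** Handles the outer norm of the L and R spaces: [N] is the inner norm as a function of its cutoff,
    [J] its discrete version, comparable uniformly on each block. *)
Lemma Lq_nested r (beta : R -> R) al (A : R) :
  0 < r -> regular al (beta \o expR) -> (0 < A)%R ->
  exists2 B : R, (0 < B)%R & forall (N : R -> \bar R) (J : int -> \bar R),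
  (forall s, 0 <= N s) -> (forall m, 0 <= J m) ->
  (forall m s, unit_block m s -> N s <= A%:E * J m /\ J m <= A%:E * N s) ->
  let F := fun t => (t `^ (- rinv r) * beta t)%:E * N t in
  let D := lnorm r (fun m => (beta (expR m%:~R))%:E * J m) in
  Lq r `]0%R, +oo[%classic F <= B%:E * D /\
  D <= B%:E * Lq r `]0%R, +oo[%classic F.
Proof.
move=> r0 rb A0; have [C C0 hC] := regular_near rb; have [b0 _] := rb.
have [B1 B10 h1] := Lq_blocks_le r0 (mulr_gt0 C0 A0).
have [B2 B20 h2] := Lq_blocks_ge r0 (mulr_gt0 C0 A0).
exists (B1 + B2)%R => [|N J N0 J0 NJ F D]; first exact: addr_gt0.
have bp s : (0 < s)%R -> (0 < beta s)%R.
  by move=> s0; have := b0 (ln s); rewrite /= lnK.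
have x0 m : 0 <= (beta (expR m%:~R))%:E * J m.
  by rewrite mule_ge0 // lee_fin ltW // bp // expR_gt0.
(* The block lemmas ask for a function that is nonnegative everywhere, while nothing is known about
   [beta] outside ]0, +oo[. *)
pose g s := (Num.max 0 (beta s))%:E * N s.
have g0 s : 0 <= g s by rewrite mule_ge0 // lee_fin le_max lexx.
have gE s : (0 < s)%R -> g s = (beta s)%:E * N s.
  by move=> s0; rewrite /g max_r // ltW // bp.
have Fg s : (0 < s)%R -> F s = (s `^ (- rinv r))%:E * g s.
  by move=> s0; rewrite gE // /F EFinM muleA.
have near1 (m : int) (s : R) : unit_block m s -> (`|ln s - m%:~R| <= 1)%R.
  by move=> /unit_block_ln[_ ? ?]; rewrite ger0_norm; lra.
split.
  apply: (@le_trans _ _ (B1%:E * D)); last first.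
    by rewrite lee_wpmul2r ?lnorm_ge0 // lee_fin lerDl ltW.
  apply: (h1 _ _ g) => // [s|m s ms _]; first by rewrite /= in_itv /= andbT.
  have [s0 _ _] := unit_block_ln ms; have [Ns _] := NJ _ _ ms.
  rewrite gE //; apply: lee_pmul_scaled => //; first exact: ltW (bp _ s0).
  by have := hC _ _ (near1 _ _ ms); rewrite /= lnK.
apply: (@le_trans _ _ (B2%:E * Lq r `]0%R, +oo[%classic F)); last first.
  by rewrite lee_wpmul2r ?Lnorm_ge0 // lee_fin lerDr ltW.
apply: (h2 _ _ g) => // m s ms _.
have [s0 _ _] := unit_block_ln ms; have [_ Js] := NJ _ _ ms.
split; first by rewrite /= in_itv /= s0.
rewrite gE //; apply: lee_pmul_scaled => //; first exact: ltW (bp _ (expR_gt0 _)).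
have := near1 _ _ ms; rewrite distrC => /hC.
by rewrite /= lnK.
Qed.

Context {V : nmodType}.
Implicit Types (X : qspace R V) (f : V).

Lemma weightedKE X0 X1 th q b f s : (0 < s)%R ->
  weightedK X0 X1 th q b f s = (s `^ (- rinv q))%:E *
    ((expR (- th * ln s) * b (expR (ln s)))%:E * Kfun X0 X1 (expR (ln s)) f).
Proof.
move=> s0; have -> : (expR (- th * ln s) = s `^ (- th))%R by rewrite /powR gt_eqF.
rewrite /weightedK muleA -EFinM lnK ?posrE // mulrA -powRD.
  by rewrite addrC.
by rewrite (gt_eqF s0) implybT.
Qed.

Definition discreteK X0 X1 (th : R) (b : R -> R) f (m : int) : \bar R :=
  (expR (- th * m%:~R) * b (expR m%:~R))%:E * Kfun X0 X1 (expR m%:~R) f.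

Lemma interp_norm_discrete (th : R) q (b : R -> R) : 0 < q -> regular 0 (b \o expR) ->
  exists2 A : R, (0 < A)%R & forall X0 X1 f,
  quasiconcave (fun x => Kfun X0 X1 (expR x) f) ->
  let D := lnorm q (discreteK X0 X1 th b f) in
  qnorm (interp X0 X1 th q b) f <= A%:E * D /\
  D <= A%:E * qnorm (interp X0 X1 th q b) f.
Proof.
move=> q0 rb; have rW := regular_interp_weight th rb.
have [C C0 hC] := weighted_unit_regular rW.
have [A A0 hA] := Lq_line q0 C0; exists A => // X0 X1 f qk.
have [W0 _] := rW; have [k0 _ _] := qk.
apply: (hA _ _ _ (hC _ qk)) => [u|s s0]; last exact: weightedKE.
by rewrite mule_ge0 // lee_fin ltW.
Qed.

Lemma interpL_norm_discrete (sigma : R) r (b : R -> R) q (a : R -> R) :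
  0 < r -> 0 < q -> regular 0 (a \o expR) -> regular 0 (b \o expR) ->
  exists2 A : R, (0 < A)%R & forall X0 X1 f,
  quasiconcave (fun x => Kfun X0 X1 (expR x) f) ->
  let D := lnorm r (fun m => (b (expR m%:~R) / a (expR m%:~R))%:E *
    lnorm q (seqcut (fun j : int => j <= m)%R (discreteK X0 X1 sigma a f))) in
  qnorm (interpL X0 X1 sigma r b q a) f <= A%:E * D /\
  D <= A%:E * qnorm (interpL X0 X1 sigma r b q a) f.
Proof.
move=> r0 q0 ra rb; have rW := regular_interp_weight sigma ra.
have [C C0 hC] := weighted_unit_regular rW.
have [A A0 hA] := Lq_below q0 C0.
have [B B0 hB] := @Lq_nested r (fun t => b t / a t)%R _ _ r0 (regularM rb (regularV ra)) A0.
exists B => // X0 X1 f qk; have [W0 _] := rW; have [k0 _ _] := qk.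
have d0 m : 0 <= discreteK X0 X1 sigma a f m.
  by rewrite mule_ge0 // lee_fin ltW.
apply: hB => [s|m|m s ms]; first exact: Lnorm_ge0.
  by apply: lnorm_ge0; exact: seqcut_ge0.
have [s0 h1 h2] := unit_block_ln ms; rewrite -[s]lnK ?posrE //.
apply: (hA _ _ _ (hC _ qk)) => // [u|t t0]; last exact: weightedKE.
by rewrite mule_ge0 // lee_fin ltW.
Qed.

Lemma interpR_norm_discrete (sigma : R) r (b : R -> R) q (a : R -> R) :
  0 < r -> 0 < q -> regular 0 (a \o expR) -> regular 0 (b \o expR) ->
  exists2 A : R, (0 < A)%R & forall X0 X1 f,
  quasiconcave (fun x => Kfun X0 X1 (expR x) f) ->
  let D := lnorm r (fun m => (b (expR m%:~R) / a (expR m%:~R))%:E *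
    lnorm q (seqcut (fun j : int => m <= j)%R (discreteK X0 X1 sigma a f))) in
  qnorm (interpR X0 X1 sigma r b q a) f <= A%:E * D /\
  D <= A%:E * qnorm (interpR X0 X1 sigma r b q a) f.
Proof.
move=> r0 q0 ra rb; have rW := regular_interp_weight sigma ra.
have [C C0 hC] := weighted_unit_regular rW.
have [A A0 hA] := Lq_above q0 C0.
have [B B0 hB] := @Lq_nested r (fun t => b t / a t)%R _ _ r0 (regularM rb (regularV ra)) A0.
exists B => // X0 X1 f qk; have [W0 _] := rW; have [k0 _ _] := qk.
have d0 m : 0 <= discreteK X0 X1 sigma a f m.
  by rewrite mule_ge0 // lee_fin ltW.
apply: hB => [s|m|m s ms]; first exact: Lnorm_ge0.
  by apply: lnorm_ge0; exact: seqcut_ge0.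
have [s0 h1 h2] := unit_block_ln ms; rewrite -[s]lnK ?posrE //.
apply: (hA _ _ _ (hC _ qk)) => // [u|t t0]; last exact: weightedKE.
by rewrite mule_ge0 // lee_fin ltW.
Qed.

End DiscreteNorms.

(** * The tail norm of a slowly varying weight *)

Section TailWeight.
Local Open Scope ereal_scope.
Context {R : realType}.
Variables (r : \bar R) (w : R -> R).
Hypotheses (r0 : 0 < r) (rw : regular 0 (w \o expR)).

Definition discrete_tail (m : int) : \bar R :=
  lnorm r (seqcut (fun j : int => m <= j)%R (fun j => (w (expR j%:~R))%:E)).

Let w0 x : (0 < w (expR x))%R. Proof. by have [+ _] := rw; exact. Qed.

Let w0e (j : int) : 0 <= (w (expR j%:~R))%:E.
Proof. by rewrite lee_fin ltW. Qed.

Lemma discrete_tail_ge m : (w (expR m%:~R))%:E <= discrete_tail m.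
Proof.
apply: le_trans (@le_lnorm _ r _ m _ r0); last exact: seqcut_ge0.
by rewrite /seqcut lexx.
Qed.

(** Moving the cutoff up only shortens the tail. Moving it down by d amounts to translating the tail
    by d, and [w] changes by at most [C * expR (e * d)] under this translation. *)
Lemma discrete_tail_growth (e : R) : (0 < e)%R ->
  exists2 C : R, (0 < C)%R & forall m n : int,
  discrete_tail m <= (C * expR (e * `|m%:~R - n%:~R|))%:E * discrete_tail n.
Proof.
move=> e0; have [_ hw] := rw; have [C C0 hC] := hw e e0.
have [A A0 hA] := lnorm_geo r0 (ltr01 : (0 < 1 :> R)%R).
exists (C * A + 1)%R => [|m n]; first by rewrite addr_gt0 // mulr_gt0.
have D0 k : 0 <= discrete_tail k by apply: lnorm_ge0; exact: seqcut_ge0.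
have [nm|mn] := leP n m.
  rewrite -[leLHS]mul1e; apply: lee_pmul => //; rewrite ?lee_fin.
    rewrite -[leLHS]mul1r ler_pM // ?lerDr ?mulr_ge0 ?(ltW C0) ?(ltW A0) //.
    by rewrite -[leLHS]expR0 ler_expR mulr_ge0 // ltW.
  apply: lnorm_le => //; first exact: seqcut_ge0.
  move=> j; rewrite /seqcut; case: ifP => [mj|_]; first by rewrite (le_trans nm).
  by case: ifP.
set d := `|m%:~R - n%:~R|%R.
have dE : d = (n - m)%:~R :> R by rewrite /d distrC -rmorphB /= ger0_norm // ler0z; lia.
(* The translation is the peak of this kernel at j = i + (n - m); the decay away from the peak is
   added so that Schur's test applies. *)
pose k (i j : int) := (C * expR (e * d) * expR (- 1 * `|i%:~R - (j - (n - m))%:~R|))%R.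
have k0 i j : (0 <= k i j)%R by rewrite !mulr_ge0 ?expR_ge0 // ltW.
have B0 : (0 < C * expR (e * d))%R by rewrite mulr_gt0 ?expR_gt0.
have kA j : lnorm r (fun i => (k i j)%:E) <= (C * expR (e * d) * A)%:E.
  under eq_fun do rewrite EFinM.
  by rewrite lnormZ // [leRHS]EFinM lee_wpmul2l // lee_fin ltW.
have xc0 : forall j, 0 <= seqcut (fun j : int => n <= j)%R (fun j => (w (expR j%:~R))%:E) j.
  exact: seqcut_ge0.
have := lnorm_schur r0 (ltW (mulr_gt0 B0 A0)) k0 xc0 kA.
move=> h; apply: (@le_trans _ _ ((C * expR (e * d) * A)%:E * discrete_tail n)); last first.
  rewrite lee_wpmul2r // lee_fin mulrAC ler_wpM2r ?expR_ge0 //.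
  by rewrite lerDl.
apply: le_trans h; apply: lnorm_le => //; first exact: seqcut_ge0.
move=> i; set z := (X in _ <= lnorm r X).
have z0 j : 0 <= z j by rewrite mule_ge0 // lee_fin.
apply: le_trans (le_lnorm (i + (n - m))%R z0 r0).
rewrite /z /seqcut; case: ifP => [mi|_]; last first.
  by case: ifP => _; rewrite ?mule0 // mule_ge0 // lee_fin.
rewrite ifT; last by lia.
rewrite /k addrK subrr normr0 mulr0 expR0 mulr1 -EFinM lee_fin.
apply: (le_trans (hC _ (i + (n - m))%:~R)).
rewrite ler_wpM2r ?(ltW (w0 _)) // ler_wpM2l ?(ltW C0) // ler_expR mul0r add0r.
rewrite ler_wpM2l ?(ltW e0) // dE intrD opprD addNKr normrN ger0_norm // ler0z; lia.
Qed.

Let W (x : R) := wnorm r `]expR x, +oo[%classic w.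

Lemma wnorm_discrete : exists2 A : R, (0 < A)%R & forall (x : R) (m : int),
  (m%:~R <= x)%R -> (x < m%:~R + 1)%R ->
  W x <= A%:E * discrete_tail m /\ discrete_tail m <= A%:E * W x.
Proof.
have [C C0 hC] := regular_near rw.
have [A A0 hA] := Lq_above r0 C0; exists A => // x m mx xm.
apply: (hA _ (fun u => (w (expR u))%:E)) => //.
- by move=> u; rewrite lee_fin ltW.
- by move=> s s0; rewrite lnK ?posrE // EFinM.
Qed.

Hypothesis wfin : wnorm r `]1%R, +oo[%classic w < +oo.

Let floorP (x : R) : ((Num.floor x)%:~R <= x)%R /\ (x < (Num.floor x)%:~R + 1)%R.
Proof.
by split; [exact: floor_le|have := floorD1_gt x; rewrite intrD].
Qed.

(** The hypothesis is the case of cutoff [expR 0]; the growth bound carries finiteness to all other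
    cutoffs. *)
Lemma discrete_tail_lty m : discrete_tail m < +oo.
Proof.
have [A A0 hA] := wnorm_discrete.
have [C C0 hC] := discrete_tail_growth ltr01.
have [_ h0] := hA 0%R 0%R (lexx _) (ltr_wpDl (lexx _) ltr01).
apply: le_lt_trans (hC m 0%R) _; apply: lte_mul_pinfty => //.
  by rewrite lee_fin mulr_ge0 ?expR_ge0 // ltW.
apply: (le_lt_trans h0); apply: lte_mul_pinfty => //; first by rewrite lee_fin ltW.
by rewrite /W expR0.
Qed.

Lemma wnorm_fineK x : (fine (W x))%:E = W x.
Proof.
have [A A0 hA] := wnorm_discrete; have [h1 h2] := floorP x.
have [h _] := hA _ _ h1 h2; rewrite fineK // ge0_fin_numE ?Lnorm_ge0 //.
apply: (le_lt_trans h); apply: lte_mul_pinfty => //; first by rewrite lee_fin ltW.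
exact: discrete_tail_lty.
Qed.

Lemma fine_wnorm_discrete : exists2 A : R, (0 < A)%R & forall m : int,
  (fine (W m%:~R))%:E <= A%:E * discrete_tail m /\
  discrete_tail m <= A%:E * (fine (W m%:~R))%:E.
Proof.
have [A A0 hA] := wnorm_discrete; exists A => // m.
by rewrite wnorm_fineK; apply: hA => //; rewrite ltrDl.
Qed.

(** With it, the function c_0, a slowly varying function times this tail, is slowly varying. *)
Lemma regular_tail : regular 0 (fun x => fine (W x)).
Proof.
have [A A0 hA] := wnorm_discrete.
split=> [x|e e0].
  have [h1 h2] := floorP x; have [_ h] := hA _ _ h1 h2.
  rewrite -lte_fin wnorm_fineK -(@lte_pmul2l _ A%:E) ?lte_fin // mule0.
  apply: lt_le_trans h; apply: lt_le_trans (discrete_tail_ge _).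
  by rewrite lte_fin.
have [C C0 hC] := discrete_tail_growth e0.
(* [A] is paid on passing to the discrete tail and again on returning; [expR e] pays for the floors,
   whose distance exceeds that of [x] and [y] by at most 1. *)
exists (A * C * A * expR e)%R => [|x y]; first by rewrite !mulr_gt0 ?expR_gt0.
have [x1 x2] := floorP x; have [y1 y2] := floorP y.
have [hx _] := hA _ _ x1 x2; have [_ hy] := hA _ _ y1 y2.
rewrite -lee_fin EFinM !wnorm_fineK.
apply: (le_trans hx).
apply: (@le_trans _ _ (A%:E * ((C * expR (e *
    `|(Num.floor x)%:~R - (Num.floor y)%:~R|))%:E * (A%:E * W y)))).
  rewrite lee_wpmul2l ?lee_fin ?(ltW A0) //.
  apply: (le_trans (hC _ (Num.floor y))); rewrite lee_wpmul2l //.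
  by rewrite lee_fin mulr_ge0 ?expR_ge0 // ltW.
rewrite !muleA -!EFinM lee_wpmul2r ?Lnorm_ge0 // lee_fin.
rewrite mul0r add0r -[leRHS]mulrA -expRD.
set u := (`|_ - _|)%R; rewrite [leLHS](_ : _ = A * C * A * expR (e * u))%R; last by ring.
rewrite ler_wpM2l ?mulr_ge0 ?(ltW A0) ?(ltW C0) // ler_expR.
have : (u <= `|x - y| + 1)%R.
  rewrite /u ler_norml; have := ler_norm (x - y); have := ler_norm (y - x).
  rewrite (distrC y x) => h3 h4; apply/andP; split; lra.
by move=> hu; have := ler_wpM2l (ltW e0) hu; lra.
Qed.

End TailWeight.

(** * Holmstedt's formula and Hardy inequalities for sequences *)

Section DiscreteHolmstedt.
Local Open Scope ereal_scope.
Context {R : realType}.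

(** Half of the exponent absorbs the slowly varying factor, the other half remains as decay. *)
Lemma regular_decay (g : R -> R) (ga : R) : (0 < ga)%R -> regular (- ga) g ->
  exists2 C : R, (0 < C)%R & forall x y : R, (y <= x)%R ->
  (g x <= C * expR (- (ga / 2) * `|x - y|) * g y)%R.
Proof.
move=> ga0 [g0 hg]; have ga20 : (0 < ga / 2)%R by rewrite divr_gt0.
have [C C0 hC] := hg _ ga20; exists C => // x y yx; apply: (le_trans (hC x y)).
rewrite ler_wpM2r ?(ltW (g0 y)) // ler_wpM2l ?(ltW C0) // ler_expR.
by rewrite ger0_norm ?subr_ge0 //; lra.
Qed.

Lemma regular_growth (g : R -> R) (ga : R) : (0 < ga)%R -> regular ga g ->
  exists2 C : R, (0 < C)%R & forall x y : R, (x <= y)%R ->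
  (g x <= C * expR (- (ga / 2) * `|x - y|) * g y)%R.
Proof.
move=> ga0 [g0 hg]; have ga20 : (0 < ga / 2)%R by rewrite divr_gt0.
have [C C0 hC] := hg _ ga20; exists C => // x y xy; apply: (le_trans (hC x y)).
rewrite ler_wpM2r ?(ltW (g0 y)) // ler_wpM2l ?(ltW C0) // ler_expR.
by rewrite ler0_norm ?subr_le0 //; lra.
Qed.

Variables (q0 r0 r1 r : \bar R) (th0 th1 : R) (W0 W1 T beta : R -> R).
Hypotheses (q0p : 0 < q0) (r0p : 0 < r0) (r1p : 0 < r1) (rp : 0 < r).
Hypotheses (th0p : (0 < th0)%R) (th01 : (th0 < th1)%R) (th11 : (th1 < 1)%R).
Hypotheses (rW0 : regular (- th0) W0) (rW1 : regular (- th1) W1).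
Hypotheses (rT : regular 0 T) (beta0 : forall x, (0 < beta x)%R).

Let tail (m : int) : \bar R :=
  lnorm r0 (seqcut (fun j : int => m <= j)%R (fun j => (beta j%:~R)%:E)).

Hypothesis tailT : exists2 A : R, (0 < A)%R & forall m : int,
  (T m%:~R)%:E <= A%:E * tail m /\ tail m <= A%:E * (T m%:~R)%:E.

(** The function rho at [expR x]: [W0] and [W1] stand for t^(-theta_0) a_0 and t^(-theta_1) b_1, and
    [T] for the tail norm of [beta], that is of b_0/a_0. So [W0 * T] is t^(-theta_0) c_0. *)
Definition rho_log (x : R) : R := (W0 x * T x / W1 x)%R.

Implicit Types (k : int -> \bar R) (m n : int).

Definition normN k m : \bar R :=
  lnorm q0 (seqcut (fun j : int => j <= m)%R (fun j => (W0 j%:~R)%:E * k j)).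
Definition normL k : \bar R :=
  lnorm r0 (fun m => (beta m%:~R)%:E * normN k m).
Definition normY k : \bar R := lnorm r1 (fun j => (W1 j%:~R)%:E * k j).
(** [part1] is the norm of the first space with outer index up to [n]. [part2] is what the outer
    indices from [n] on contribute when the inner norm is frozen at [n], since [T] is the norm of
    the remaining [beta]. [part3] is the share of the second space. *)
Definition part1 k n : \bar R := lnorm r0
  (seqcut (fun m : int => m <= n)%R (fun m => (beta m%:~R)%:E * normN k m)).
Definition part2 k n : \bar R := (T n%:~R)%:E * normN k n.
Definition part3 k n : \bar R := (rho_log n%:~R)%:E *
  lnorm r1 (seqcut (fun j : int => n <= j)%R (fun j => (W1 j%:~R)%:E * k j)).

Let W0p x : (0 < W0 x)%R. Proof. by have [+ _] := rW0; exact. Qed.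
Let W1p x : (0 < W1 x)%R. Proof. by have [+ _] := rW1; exact. Qed.
Let Tp x : (0 < T x)%R. Proof. by have [+ _] := rT; exact. Qed.
Let rhop x : (0 < rho_log x)%R.
Proof. by rewrite divr_gt0 // mulr_gt0. Qed.

Let W0e x : 0 <= (W0 x)%:E. Proof. by rewrite lee_fin ltW. Qed.
Let W1e x : 0 <= (W1 x)%:E. Proof. by rewrite lee_fin ltW. Qed.
Let Te x : 0 <= (T x)%:E. Proof. by rewrite lee_fin ltW. Qed.
Let betae x : 0 <= (beta x)%:E. Proof. by rewrite lee_fin ltW. Qed.
Let rhoe x : 0 <= (rho_log x)%:E. Proof. by rewrite lee_fin ltW. Qed.

Lemma regular_rho_log : regular (th1 - th0) rho_log.
Proof.
have := regularM (regularM rW0 rT) (regularV rW1).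
by rewrite addr0 opprK addrC.
Qed.

Let rhoW1 x : (rho_log x * W1 x = W0 x * T x)%R.
Proof. by rewrite divfK // gt_eqF. Qed.

Let pos_mul (a : R) (z : \bar R) : (0 < a)%R -> 0 <= z -> 0 <= a%:E * z.
Proof. by move=> a0 z0; rewrite mule_ge0 // lee_fin ltW. Qed.

Section Nonnegative.
Variable k : int -> \bar R.
Hypothesis k0 : forall j, 0 <= k j.

Lemma normN_ge0 m : 0 <= normN k m.
Proof. by apply: lnorm_ge0; apply: seqcut_ge0 => j; exact: pos_mul. Qed.

Lemma normL_ge0 : 0 <= normL k.
Proof. by apply: lnorm_ge0 => m; apply: pos_mul => //; exact: normN_ge0. Qed.

Lemma normY_ge0 : 0 <= normY k.
Proof. by apply: lnorm_ge0 => m; exact: pos_mul. Qed.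

Lemma part1_ge0 n : 0 <= part1 k n.
Proof.
apply: lnorm_ge0; apply: seqcut_ge0 => m; apply: pos_mul => //.
exact: normN_ge0.
Qed.

Lemma part2_ge0 n : 0 <= part2 k n.
Proof. by apply: pos_mul => //; exact: normN_ge0. Qed.

Lemma part3_ge0 n : 0 <= part3 k n.
Proof.
apply: pos_mul => //; apply: lnorm_ge0; apply: seqcut_ge0 => m.
exact: pos_mul.
Qed.

(** The diagonal term [j = n] of the tail, rewritten by [rhoW1]. Through it [part3] controls the
    other two parts. *)
Lemma le_part3 n : (W0 n%:~R * T n%:~R)%:E * k n <= part3 k n.
Proof.
rewrite -rhoW1 EFinM -muleA lee_wpmul2l //.
apply: le_trans (@le_lnorm _ r1 _ n _ r1p); first by rewrite /seqcut lexx.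
by apply: seqcut_ge0 => j; exact: pos_mul.
Qed.

End Nonnegative.

(** Beyond [n] the bound on [k0] is constant while [W0] decays, thanks to theta_0 > 0; all those
    terms are charged to the index [n]. *)
Lemma normN_min (c : R) : (0 < c)%R -> exists2 A : R, (0 < A)%R &
  forall k k0 m n, (forall j, 0 <= k j) -> (forall j, 0 <= k0 j) ->
  (forall j, k0 j <= c%:E * k (Num.min j n)) ->
  normN k0 m <= A%:E * normN k (Num.min m n).
Proof.
move=> c0; have [C C0 hC] := regular_decay th0p rW0.
have [A A0 hA] := lnorm_dom q0p (divr_gt0 th0p (ltr0Sn R 1)) (mulr_gt0 C0 c0).
exists A => // k k0 m n kp k0p kk; apply: hA.
- by apply: seqcut_ge0 => j; exact: pos_mul.
- by apply: seqcut_ge0 => j; exact: pos_mul.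
move=> j; exists (Num.min j n); rewrite /seqcut.
case: ifP => [jm|_]; last first.
  rewrite mule_ge0 ?lee_fin ?mulr_ge0 ?expR_ge0 ?(ltW C0) ?(ltW c0) //.
  by case: ifP => // _; exact: pos_mul.
rewrite ifT; last by rewrite le_min !ge_min jm lexx orbT.
rewrite mulrAC; apply: lee_pmul_scaled => //; first exact: ltW.
by apply: hC; rewrite ler_int ge_min lexx.
Qed.

(** Below [n] the bound on [k1] is linear in [expR j], and [expR j] times [W1] has the positive
    exponent 1 - theta_1; all those terms are charged to the index [n]. *)
Lemma normY_max (c : R) : (0 < c)%R -> exists2 A : R, (0 < A)%R &
  forall k k1 n, (forall j, 0 <= k j) -> (forall j, 0 <= k1 j) ->
  (forall j, k1 j <= (c * expR (j%:~R - (Num.max j n)%:~R))%:E * k (Num.max j n)) ->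
  (rho_log n%:~R)%:E * normY k1 <= A%:E * part3 k n.
Proof.
move=> c0; have rg := regularM (regular_exp (1 : R)) rW1.
have th1p : (0 < 1 - th1)%R by rewrite subr_gt0.
have [C C0 hC] := regular_growth th1p rg.
have [A A0 hA] := lnorm_dom r1p (divr_gt0 th1p (ltr0Sn R 1)) (mulr_gt0 C0 c0).
exists A => // k k1 n kp k1p kk; rewrite [leRHS]muleCA lee_wpmul2l //.
apply: hA => [|j|j]; first by apply: seqcut_ge0 => j; exact: pos_mul.
  exact: pos_mul.
exists (Num.max j n); rewrite /seqcut ifT; last by rewrite le_max lexx orbT.
set i := Num.max j n.
apply: (@le_trans _ _ ((W1 j%:~R)%:E * ((c * expR (j%:~R - i%:~R))%:E * k i))).
  by rewrite lee_wpmul2l.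
rewrite !muleA -!EFinM lee_wpmul2r // lee_fin.
have ji : (j%:~R <= i%:~R :> R)%R by rewrite ler_int /i le_max lexx.
have := hC _ _ ji; rewrite !mul1r => h.
rewrite expRD mulrC -(ler_pM2l (expR_gt0 (i%:~R : R))).
have -> : (expR i%:~R * (c * (expR j%:~R * expR (- i%:~R)) * W1 j%:~R) =
           c * (expR j%:~R * W1 j%:~R) :> R)%R.
  by rewrite expRN; field; rewrite gt_eqF // expR_gt0.
apply: le_trans (ler_wpM2l (ltW c0) h) _.
by rewrite le_eqVlt; apply/orP; left; apply/eqP; ring.
Qed.

Lemma holmstedt_upper (c : R) : (0 < c)%R -> exists2 A : R, (0 < A)%R &
  forall k k0 k1 n, (forall j, 0 <= k j) -> (forall j, 0 <= k0 j) ->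
  (forall j, 0 <= k1 j) ->
  (forall j, k0 j <= c%:E * k (Num.min j n)) ->
  (forall j, k1 j <= (c * expR (j%:~R - (Num.max j n)%:~R))%:E * k (Num.max j n)) ->
  normL k0 <= A%:E * (part1 k n + part2 k n) /\
  (rho_log n%:~R)%:E * normY k1 <= A%:E * part3 k n.
Proof.
move=> c0; have [A A0 hA] := normN_min c0; have [B B0 hB] := normY_max c0.
have [D D0 hD] := lnormD r0p; have [E E0 hE] := tailT.
exists (A * D * (1 + E) + B)%R.
  by rewrite addr_gt0 // !mulr_gt0 // addr_gt0.
move=> k k0 k1 n kp k0p k1p kk0 kk1.
have P1 := part1_ge0 kp n; have P2 := part2_ge0 kp n; have P3 := part3_ge0 kp n.
have N0 m := normN_ge0 kp m.
split; last first.
  apply: (le_trans (hB _ _ _ kp k1p kk1)).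
  rewrite lee_wpmul2r // lee_fin lerDr !mulr_ge0 ?addr_ge0 ?(ltW A0) ?(ltW D0) ?(ltW E0) //.
(* The outer norm is split at [n]: for m <= n the inner norm of [k0] is compared with that of [k] at
   m (term [u]), beyond [n] with the fixed value at [n] (factor of [v]). The norm of [v] is the tail
   comparable to [T]. *)
pose u := seqcut (fun m : int => m <= n)%R (fun m => (beta m%:~R)%:E * normN k m).
pose v := seqcut (fun j : int => n <= j)%R (fun j => (beta j%:~R)%:E).
have u0 m : 0 <= u m by apply: seqcut_ge0 => i; exact: pos_mul.
have v0 m : 0 <= v m by apply: seqcut_ge0 => i; rewrite lee_fin ltW.
have uv0 m : 0 <= u m + normN k n * v m by rewrite adde_ge0 // mule_ge0.
have step1 : normL k0 <= A%:E * lnorm r0 (fun m => u m + normN k n * v m).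
  rewrite -lnormZ //; apply: lnorm_le => // m.
    by apply: pos_mul => //; exact: normN_ge0.
  apply: (@le_trans _ _ ((beta m%:~R)%:E * (A%:E * normN k (Num.min m n)))).
    by rewrite lee_wpmul2l // hA.
  rewrite muleCA lee_wpmul2l ?lee_fin ?(ltW A0) // /u /v /seqcut.
  have [mn|nm] := leP m n.
    by rewrite leeDl // mule_ge0 //; case: ifP => // _; rewrite lee_fin ltW.
  by rewrite (ltW nm) add0e muleC.
apply: (le_trans step1).
apply: (@le_trans _ _ (A%:E * (D%:E * (part1 k n + E%:E * part2 k n)))).
  rewrite lee_wpmul2l ?lee_fin ?(ltW A0) //.
  apply: (le_trans (hD _ _ u0 _)) => [m|]; first by rewrite mule_ge0.
  rewrite lee_wpmul2l ?lee_fin ?(ltW D0) // leeD2l //.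
  apply: (le_trans (lnormZ_le r0p (N0 n) v0)).
  rewrite /part2 muleA muleC lee_wpmul2r //.
  by have [_] := hE n.
rewrite [leLHS]muleA -[A%:E * _]EFinM.
apply: (@le_trans _ _ ((A * D)%:E * ((1 + E)%:E * (part1 k n + part2 k n)))).
  rewrite lee_wpmul2l ?lee_fin ?mulr_ge0 ?(ltW A0) ?(ltW D0) // ge0_muleDr // leeD //.
    by rewrite -[leLHS]mul1e lee_wpmul2r // lee_fin lerDl ltW.
  by rewrite lee_wpmul2r // lee_fin lerDr.
rewrite muleA -EFinM lee_wpmul2r ?adde_ge0 // lee_fin.
by rewrite lerDl ltW.
Qed.

(** For every outer index m >= n the inner norm contains the term [W0 * k] at [n]; summing these
    constants against [beta] produces the tail. *)
Lemma le_normL : exists2 A : R, (0 < A)%R & forall k n,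
  (forall j, 0 <= k j) ->
  (W0 n%:~R * T n%:~R)%:E * k n <= A%:E * normL k.
Proof.
have [A A0 hA] := tailT; exists A => // k n kp.
have [hT _] := hA n.
have c0 : 0 <= (W0 n%:~R)%:E * k n by exact: pos_mul.
have v0 m : 0 <= seqcut (fun j : int => n <= j)%R (fun j => (beta j%:~R)%:E) m.
  by apply: seqcut_ge0 => i; rewrite lee_fin ltW.
rewrite mulrC EFinM -muleA; apply: (@le_trans _ _ ((A%:E * tail n) * ((W0 n%:~R)%:E * k n))).
  by rewrite lee_wpmul2r.
rewrite -muleA lee_wpmul2l ?lee_fin ?(ltW A0) // muleC.
apply: (le_trans (lnormZ_ge r0p c0 v0)); apply: lnorm_le => // [m|m].
  by rewrite mule_ge0.
rewrite /seqcut; case: ifP => [nm|_]; last first.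
  by rewrite mule0 pos_mul // normN_ge0.
rewrite muleC lee_wpmul2l //.
apply: le_trans (@le_lnorm _ q0 _ n _ q0p); first by rewrite /seqcut nm.
by apply: seqcut_ge0 => j; exact: pos_mul.
Qed.

(** Each term of the tail equals rho_n/rho_j times [W0 * T * k] at [j]. The quotient decays
    geometrically because theta_0 < theta_1, and the rest is bounded by [le_normL]. *)
Lemma part3_normL : exists2 A : R, (0 < A)%R & forall k n,
  (forall j, 0 <= k j) -> part3 k n <= A%:E * normL k.
Proof.
have th10 : (0 < th1 - th0)%R by rewrite subr_gt0.
have [C C0 hC] := regular_growth th10 regular_rho_log.
have [A A0 hA] := le_normL.
have [B B0 hB] := lnorm_geo r1p (divr_gt0 th10 (ltr0Sn R 1)).
exists (A * C * B)%R => [|k n kp]; first by rewrite !mulr_gt0.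
have L0 := normL_ge0 kp.
have cut0 j : 0 <= seqcut (fun j : int => n <= j)%R (fun j => (W1 j%:~R)%:E * k j) j.
  by apply: seqcut_ge0 => i; exact: pos_mul.
rewrite /part3 -lnormZ //.
pose x (j : int) := (expR (- ((th1 - th0) / 2) * `|j%:~R - n%:~R|))%:E.
have x0 j : 0 <= x j by rewrite lee_fin expR_ge0.
apply: (@le_trans _ _ (lnorm r1 (fun j => ((A * C)%:E * normL k) * x j))); last first.
  have AC0 : 0 <= (A * C)%:E * normL k by rewrite pos_mul // mulr_gt0.
  apply: (le_trans (lnormZ_le r1p AC0 x0)).
  by rewrite [X in _ <= X * _]EFinM [leRHS]muleAC lee_wpmul2l //; exact: hB.
apply: lnorm_le => // [j|j]; first by rewrite pos_mul.
have rhs0 : 0 <= (A * C)%:E * normL k * x j.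
  by rewrite mule_ge0 // pos_mul // mulr_gt0.
rewrite /seqcut; case: ifP => [nj|_]; last by rewrite mule0.
have nj' : (n%:~R <= j%:~R :> R)%R by rewrite ler_int.
have h := hC _ _ nj'.
apply: (@le_trans _ _ ((C * expR (- ((th1 - th0) / 2) * `|n%:~R - j%:~R|))%:E *
    ((W0 j%:~R * T j%:~R)%:E * k j))).
  rewrite -rhoW1 [X in _ <= _ * X](_ : _ = (rho_log j%:~R)%:E * ((W1 j%:~R)%:E * k j)).
    by rewrite [leRHS]muleA -EFinM lee_wpmul2r ?lee_fin // pos_mul.
  by rewrite muleA -EFinM.
apply: (@le_trans _ _ ((C * expR (- ((th1 - th0) / 2) * `|n%:~R - j%:~R|))%:E * (A%:E * normL k))).
  by rewrite lee_wpmul2l ?lee_fin ?mulr_ge0 ?expR_ge0 ?(ltW C0) // hA.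
rewrite /x [leRHS]muleAC muleA -!EFinM lee_wpmul2r // lee_fin distrC.
by rewrite le_eqVlt; apply/orP; left; apply/eqP; ring.
Qed.

(** The share of [kg] in [part3] is bounded by [part3_normL]; for that of [kh] the cutoff is
    dropped. *)
Lemma holmstedt_lower (c : R) : (0 < c)%R -> exists2 A : R, (0 < A)%R &
  forall k kg kh n, (forall j, 0 <= k j) -> (forall j, 0 <= kg j) ->
  (forall j, 0 <= kh j) ->
  (forall j, k j <= c%:E * (kg j + kh j)) ->
  part3 k n <= A%:E * (normL kg + (rho_log n%:~R)%:E * normY kh).
Proof.
move=> c0; have [A A0 hA] := part3_normL; have [D D0 hD] := lnormD r1p.
exists (c * D * (A + 1))%R => [|k kg kh n kp kgp khp kk].
  by rewrite !mulr_gt0 // addr_gt0.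
pose v f := seqcut (fun j : int => n <= j)%R (fun j => (W1 j%:~R)%:E * f j).
have v0 f : (forall j, 0 <= f j) -> forall j, 0 <= v f j.
  by move=> f0; apply: seqcut_ge0 => j; exact: pos_mul.
have L0 := normL_ge0 kgp; have Y0 := normY_ge0 khp.
have step1 : part3 k n <= (c * D)%:E * (part3 kg n + part3 kh n).
  rewrite /part3 -ge0_muleDr ?lnorm_ge0 //; try exact: v0.
  rewrite [leRHS]muleCA lee_wpmul2l // EFinM -muleA.
  apply: (@le_trans _ _ (c%:E * lnorm r1 (fun j => v kg j + v kh j))).
    rewrite -lnormZ // => [|j]; last by rewrite adde_ge0 // v0.
    apply: lnorm_le => //; first exact: v0.
    move=> j; rewrite /v /seqcut; case: ifP => _; last by rewrite adde0 mule0.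
    rewrite -ge0_muleDr // muleCA lee_wpmul2l //.
  by rewrite lee_wpmul2l ?lee_fin ?(ltW c0) // hD //; exact: v0.
apply: (le_trans step1).
rewrite [X in _ <= X * _]EFinM -[leRHS]muleA lee_wpmul2l ?lee_fin ?mulr_ge0 ?(ltW c0) ?(ltW D0) //.
rewrite ge0_muleDr // ?pos_mul //; apply: leeD.
  apply: (le_trans (hA _ n kgp)); rewrite lee_wpmul2r // lee_fin lerDl //.
rewrite -[leLHS]mul1e; apply: lee_pmul => //; first exact: part3_ge0.
  by rewrite lee_fin lerDr ltW.
rewrite /part3 lee_wpmul2l //; apply: lnorm_le => //.
  exact: v0.
by move=> j; rewrite /seqcut; case: ifP => // _; exact: pos_mul.
Qed.

(** The weight moves into the kernel: on [S] the quotient of its values at [n] and [j] decays, which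
    is the shape asked for by [lnorm_hardy]. *)
Lemma hardy_kernel q (g : R -> R) (S : int -> pred int) (e C : R) :
  0 < q -> (0 < e)%R -> (0 < C)%R -> (forall x, (0 < g x)%R) ->
  (forall n j, S n j ->
    (g n%:~R <= C * expR (- e * `|n%:~R - j%:~R|) * g j%:~R)%R) ->
  exists2 A : R, (0 < A)%R & forall z : int -> \bar R, (forall j, 0 <= z j) ->
  lnorm r (fun n => (g n%:~R)%:E * lnorm q (seqcut (S n) z)) <=
  A%:E * lnorm r (fun j => (g j%:~R)%:E * z j).
Proof.
move=> qp e0 C0 gp hg; have [A A0 hA] := lnorm_hardy qp rp e0 C0.
exists A => // z z0.
have c0 n j : 0 <= seqcut (S n) z j by exact: seqcut_ge0.
have y0 n j : 0 <= (g n%:~R)%:E * seqcut (S n) z j by exact: pos_mul.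
have x0 j : 0 <= (g j%:~R)%:E * z j by exact: pos_mul.
apply: le_trans (hA _ (fun n j => (g n%:~R)%:E * seqcut (S n) z j) x0 y0 _).
  apply: lnorm_le => // n; last by rewrite lnormZ.
  by apply: pos_mul => //; exact: lnorm_ge0.
move=> n j; rewrite /seqcut; case: ifP => [Snj|_]; last first.
  by rewrite mule0 mule_ge0 // lee_fin mulr_ge0 ?expR_ge0 // ltW.
by rewrite muleA -EFinM lee_wpmul2r // lee_fin hg.
Qed.

Variables (w : R -> R) (ga : R).
Hypotheses (ga0 : (0 < ga)%R) (rw : regular (- ga) w).

Let wp x : (0 < w x)%R. Proof. by have [+ _] := rw; exact. Qed.

Lemma hardy_part2 : exists2 A : R, (0 < A)%R & forall k, (forall j, 0 <= k j) ->
  lnorm r (fun n => (w n%:~R)%:E * part2 k n) <=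
  A%:E * lnorm r (fun n => (w n%:~R)%:E * ((W0 n%:~R * T n%:~R)%:E * k n)).
Proof.
have rwT : regular (- ga) (fun x => w x * T x)%R.
  by have := regularM rw rT; rewrite addr0.
have [C C0 hC] := regular_decay ga0 rwT.
have [A A0 hA] := @hardy_kernel q0 (fun x => w x * T x)%R
  (fun n j => (j <= n)%R) (ga / 2)%R C q0p (divr_gt0 ga0 (ltr0Sn R 1)) C0
  (fun x => mulr_gt0 (wp x) (Tp x))
  (fun n j nj => hC _ _ (etrans (ler_int _ _ _) nj)).
exists A => // k kp.
have z0 j : 0 <= (W0 j%:~R)%:E * k j by exact: pos_mul.
rewrite (_ : (fun n => _) = (fun n => (w n%:~R * T n%:~R)%:E *
  lnorm q0 (seqcut (fun j : int => j <= n)%R (fun j => (W0 j%:~R)%:E * k j)))).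
  apply: (le_trans (hA _ z0)).
  rewrite [X in _ <= _ * lnorm _ X](_ : _ = (fun j =>
    (w j%:~R * T j%:~R)%:E * ((W0 j%:~R)%:E * k j))) //.
  by apply/funext => j; rewrite !muleA -!EFinM; congr (_ %:E * _); ring.
by apply/funext => n; rewrite EFinM -muleA.
Qed.

(** [beta] is a single term of its own tail, so [beta * normN] is at most a multiple of [part2]; the
    sum over indices up to [n] is harmless because [w] decays. *)
Lemma hardy_part1 : exists2 A : R, (0 < A)%R & forall k, (forall j, 0 <= k j) ->
  lnorm r (fun n => (w n%:~R)%:E * part1 k n) <=
  A%:E * lnorm r (fun n => (w n%:~R)%:E * part2 k n).
Proof.
have [E E0 hE] := tailT.
have betaT (m : int) : (beta m%:~R <= E * T m%:~R)%R.
  rewrite -lee_fin EFinM; apply: le_trans (hE m).2.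
  apply: le_trans (@le_lnorm _ r0 _ m _ r0p); first by rewrite /seqcut lexx.
  exact: seqcut_ge0.
have [C C0 hC] := regular_decay ga0 rw.
have [A A0 hA] := @hardy_kernel r0 w
  (fun n j => (j <= n)%R) (ga / 2)%R C r0p (divr_gt0 ga0 (ltr0Sn R 1)) C0 wp
  (fun n j nj => hC _ _ (etrans (ler_int _ _ _) nj)).
exists (A * E)%R => [|k kp]; first exact: mulr_gt0.
have N0 m : 0 <= normN k m by exact: normN_ge0.
have z0 j : 0 <= (beta j%:~R)%:E * normN k j by exact: pos_mul.
apply: (le_trans (hA _ z0)); rewrite EFinM -muleA lee_wpmul2l ?lee_fin ?(ltW A0) //.
rewrite -lnormZ // => [|n]; last by apply: pos_mul => //; exact: part2_ge0.
apply: lnorm_le => // [n|n]; first exact: pos_mul.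
rewrite [leRHS]muleCA lee_wpmul2l ?lee_fin ?(ltW (wp _)) // /part2 muleA -EFinM.
by rewrite lee_wpmul2r // lee_fin.
Qed.

(** The weight [w * rho_log] in front of the tail has exponent [th1 - th0 - ga], and its positivity
    is what lets the tail collapse to its diagonal term. *)
Lemma hardy_part3 : (ga < th1 - th0)%R ->
  exists2 A : R, (0 < A)%R & forall k, (forall j, 0 <= k j) ->
  lnorm r (fun n => (w n%:~R)%:E * part3 k n) <=
  A%:E * lnorm r (fun n => (w n%:~R)%:E * ((W0 n%:~R * T n%:~R)%:E * k n)).
Proof.
move=> gad; have de0 : (0 < th1 - th0 - ga)%R by rewrite subr_gt0.
have rwr : regular (th1 - th0 - ga) (fun x => w x * rho_log x)%R.
  by have := regularM rw regular_rho_log; rewrite addrC.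
have [C C0 hC] := regular_growth de0 rwr.
have [A A0 hA] := @hardy_kernel r1 (fun x => w x * rho_log x)%R
  (fun n j => (n <= j)%R) ((th1 - th0 - ga) / 2)%R C r1p
  (divr_gt0 de0 (ltr0Sn R 1)) C0
  (fun x => mulr_gt0 (wp x) (rhop x))
  (fun n j nj => hC _ _ (etrans (ler_int _ _ _) nj)).
exists A => // k kp.
have z0 j : 0 <= (W1 j%:~R)%:E * k j by exact: pos_mul.
rewrite (_ : (fun n => _) = (fun n => (w n%:~R * rho_log n%:~R)%:E *
  lnorm r1 (seqcut (fun j : int => n <= j)%R (fun j => (W1 j%:~R)%:E * k j)))).
  apply: (le_trans (hA _ z0)).
  rewrite [X in _ <= _ * lnorm _ X](_ : _ = (fun j =>
    (w j%:~R * rho_log j%:~R)%:E * ((W1 j%:~R)%:E * k j))) //.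
  by apply/funext => j; rewrite -rhoW1 !muleA -!EFinM mulrA.
by apply/funext => n; rewrite EFinM -muleA.
Qed.

(** In weighted norm, [part1] is dominated by [part2], that by the sequence [W0 * T * k], and this
    termwise by [part3]. Only [ga > 0] enters, so theta = 1 is included. *)
Lemma hardy_parts : exists2 A : R, (0 < A)%R & forall k, (forall j, 0 <= k j) ->
  lnorm r (fun n => (w n%:~R)%:E * (part1 k n + part2 k n + part3 k n)) <=
  A%:E * lnorm r (fun n => (w n%:~R)%:E * part3 k n).
Proof.
have [A A0 hA] := hardy_part2; have [B B0 hB] := hardy_part1.
have [D D0 hD] := lnormD rp.
exists (D * (D * (B * A + A) + 1))%R.
  by rewrite !(mulr_gt0, addr_gt0).
move=> k kp; set Z := lnorm r (fun n => (w n%:~R)%:E * part3 k n).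
have q1 n : 0 <= (w n%:~R)%:E * part1 k n by apply: pos_mul => //; exact: part1_ge0.
have q2 n : 0 <= (w n%:~R)%:E * part2 k n by apply: pos_mul => //; exact: part2_ge0.
have q3 n : 0 <= (w n%:~R)%:E * part3 k n by apply: pos_mul => //; exact: part3_ge0.
have Z0 : 0 <= Z by exact: lnorm_ge0.
have h2 : lnorm r (fun n => (w n%:~R)%:E * part2 k n) <= A%:E * Z.
  apply: (le_trans (hA _ kp)); rewrite lee_wpmul2l ?lee_fin ?(ltW A0) //.
  apply: lnorm_le => // n.
    by rewrite pos_mul // mule_ge0 // lee_fin mulr_ge0 // ltW.
  by rewrite lee_wpmul2l ?lee_fin ?(ltW (wp _)) //; exact: le_part3.
have h1 : lnorm r (fun n => (w n%:~R)%:E * part1 k n) <= (B * A)%:E * Z.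
  apply: (le_trans (hB _ kp)); rewrite EFinM -muleA.
  by rewrite lee_wpmul2l ?lee_fin ?(ltW B0).
have -> : (fun n => (w n%:~R)%:E * (part1 k n + part2 k n + part3 k n)) =
  (fun n => ((w n%:~R)%:E * part1 k n + (w n%:~R)%:E * part2 k n) +
            (w n%:~R)%:E * part3 k n).
  apply/funext => n.
  by rewrite !ge0_muleDr ?adde_ge0 //; rewrite ?part1_ge0 ?part2_ge0 ?part3_ge0.
apply: (le_trans (hD _ _ _ q3)); first by move=> n; rewrite adde_ge0.
rewrite [X in _ <= X * _]EFinM -[leRHS]muleA lee_wpmul2l ?lee_fin ?(ltW D0) //.
rewrite EFinD ge0_muleDl ?lee_fin ?mulr_ge0 ?addr_ge0 ?mulr_ge0
  ?(ltW A0) ?(ltW B0) ?(ltW D0) // mul1e.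
rewrite leeD2r //; apply: (le_trans (hD _ _ q1 q2)).
rewrite [X in _ <= X * _]EFinM -[leRHS]muleA lee_wpmul2l ?lee_fin ?(ltW D0) //.
by rewrite EFinD ge0_muleDl ?lee_fin ?mulr_ge0 ?(ltW A0) ?(ltW B0) // leeD.
Qed.

End DiscreteHolmstedt.

(** * Replacing the integers by the points ln rho_n *)

Section Reindexing.
Local Open Scope ereal_scope.
Context {R : realType}.
Variables (rho : R -> R) (de : R).
Hypotheses (de0 : (0 < de)%R) (rrho : regular de rho).

Let la (n : int) : R := ln (rho n%:~R).

Let rho0 x : (0 < rho x)%R. Proof. by have [+ _] := rrho; exact. Qed.

(** The sequence [la] need not be monotone; it grows at rate [de / 2] up to the additive constant
    [c]. *)
Let ln_rho_growth : exists c : R, forall m n : int, (m <= n)%R ->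
  (la m + de / 2 * (n - m)%:~R - c <= la n)%R.
Proof.
have [C C0 hC] := regular_growth de0 rrho.
exists (ln C) => m n mn; have mn' : (m%:~R <= n%:~R :> R)%R by rewrite ler_int.
have := hC _ _ mn'; rewrite -{1}[rho m%:~R]lnK ?posrE //.
rewrite -{1}[rho n%:~R]lnK ?posrE // -{1}[C]lnK ?posrE // -!expRD ler_expR.
rewrite ler0_norm ?subr_le0 // intrB /la; lra.
Qed.

(** A discrete intermediate value argument: [la] passes from below [y] to above it in steps bounded
    by [regular_ln], and the last index before the first crossing is close to [y]. *)
Lemma ln_rho_dense : exists2 M : R, (0 < M)%R &
  forall y : R, exists n : int, (`|la n - y| <= M)%R.
Proof.
have [c hc] := ln_rho_growth; have [D D0 hD] := regular_ln rrho.
exists (D + (`|de| + 1))%R => [|y]; first by rewrite addr_gt0 // ltr_wpDl.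
(* Chosen so that [la (- k1)] lies below [y] and [la k1] above it, by [ln_rho_growth] compared with
   the index 0. *)
pose k1 := Num.bound (2 / de * (`|la 0| + `|c| + `|y|))%R.
have bound k : (k1 <= k)%N -> (`|la 0| + `|c| + `|y| < de / 2 * k%:R)%R.
  move=> kk; have : (2 / de * (`|la 0| + `|c| + `|y|) < k%:R)%R.
    apply: lt_le_trans (archi_boundP _) _; last by rewrite ler_nat.
    by rewrite !mulr_ge0 ?addr_ge0 ?invr_ge0 ?(ltW de0).
  by rewrite mulrAC ltr_pdivrMr // => h; lra.
have := ler_norm (la 0); have := ler_norm (- la 0); rewrite normrN.
have := ler_norm c; have := ler_norm (- c); rewrite normrN.
have := ler_norm y; have := ler_norm (- y); rewrite normrN.
move=> y1 y2 c1 c2 l1 l2.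
have low : (la (- k1%:Z) <= y)%R.
  have := hc (- k1%:Z)%R 0%R; rewrite oppr_le0 sub0r opprK => /(_ isT).
  by have := bound k1 (leqnn _); rewrite -[(k1%:Z)%:~R]/(k1%:R); lra.
have ex : exists k : nat, (y < la (- k1%:Z + k%:Z))%R.
  exists (k1 + k1)%N; have := hc 0%R (k1%:Z)%R isT; rewrite subr0.
  have -> : (- k1%:Z + (k1 + k1)%:Z = k1%:Z)%R by rewrite PoszD addKr.
  by have := bound k1 (leqnn _); rewrite -[(k1%:Z)%:~R]/(k1%:R); lra.
case: (ex_minnP ex) => -[|k] hk kmin.
  by move: hk; rewrite addr0 ltNge low.
have lek : (la (- k1%:Z + k%:Z) <= y)%R.
  by rewrite leNgt; apply/negP => /kmin; rewrite ltnn.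
exists (- k1%:Z + k%:Z)%R; rewrite ler0_norm ?subr_le0 // opprB.
have := hD (- k1%:Z + k.+1%:Z)%:~R (- k1%:Z + k%:Z)%:~R.
have -> : ((- k1%:Z + k.+1%:Z)%:~R - (- k1%:Z + k%:Z)%:~R = 1 :> R)%R.
  by rewrite -intrB opprD addrACA subrr add0r -addn1 PoszD addrAC subrr add0r.
rewrite normr1 mulr1 -!/(la _) ler_norml => /andP[_]; lra.
Qed.

(** Each integer has a point ln rho_n nearby by [ln_rho_dense], and the points do not accumulate by
    [ln_rho_growth]; [G] changes by bounded factors over bounded distances. Each direction is one
    application of Schur's test. *)
Lemma lnorm_reindex (r : \bar R) (C M : R) : 0 < r -> (0 < C)%R -> (0 < M)%R ->
  exists2 A : R, (0 < A)%R & forall G : R -> \bar R, (forall x, 0 <= G x) ->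
  (forall x y, G x <= (C * expR (M * `|x - y|))%:E * G y) ->
  lnorm r (fun m => G m%:~R) <=
    A%:E * lnorm r (fun n => G (ln (rho n%:~R))) /\
  lnorm r (fun n => G (ln (rho n%:~R))) <= A%:E * lnorm r (fun m => G m%:~R).
Proof.
move=> r0 C0 M0; have [N N0 hN] := ln_rho_dense.
have [B B0 hB] := lnorm_geo r0 (ltr01 : (0 < 1 :> R)%R).
have [c hc] := ln_rho_growth.
have de20 : (0 < de / 2)%R by rewrite divr_gt0.
have [E E0 hE] := lnorm_geo r0 de20.
pose D1 := (C * expR (M * N) * expR N)%R.
have D10 : (0 < D1)%R by rewrite !mulr_gt0 ?expR_gt0.
pose D2 := (C * expR M * expR 1)%R.
have D20 : (0 < D2)%R by rewrite !mulr_gt0 ?expR_gt0.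
pose F := expR (`|c| + N).
have F0 : (0 < F)%R by exact: expR_gt0.
exists (D1 * B + D2 * (F * E))%R => [|G G0 GG].
  exact: addr_gt0 (mulr_gt0 D10 B0) (mulr_gt0 D20 (mulr_gt0 F0 E0)).
have X0 : 0 <= lnorm r (fun n => G (ln (rho n%:~R))) by exact: lnorm_ge0.
have Y0 : 0 <= lnorm r (fun m => G m%:~R) by exact: lnorm_ge0.
split.
  pose k (m n : int) := (D1 * expR (- 1 * `|m%:~R - la n|))%R.
  have k0 m n : (0 <= k m n)%R by rewrite mulr_ge0 ?expR_ge0 // ltW.
  have kB n : lnorm r (fun m => (k m n)%:E) <= (D1 * B)%:E.
    under eq_fun do rewrite EFinM.
    by rewrite lnormZ // [leRHS]EFinM lee_wpmul2l // lee_fin ltW.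
  have Gla n : 0 <= G (la n) by [].
  have := lnorm_schur r0 (ltW (mulr_gt0 D10 B0)) k0 Gla kB => h.
  apply: (@le_trans _ _ ((D1 * B)%:E * lnorm r (fun n => G (la n)))); last first.
    by rewrite lee_wpmul2r // lee_fin lerDl ltW // mulr_gt0 ?(mulr_gt0 F0 E0).
  apply: le_trans h; apply: lnorm_le => // m.
  have [n mn] := hN m%:~R; rewrite distrC in mn.
  have kG0 j : 0 <= (k m j)%:E * G (la j) by rewrite mule_ge0 // lee_fin.
  apply: le_trans (le_lnorm n kG0 r0).
  apply: (le_trans (GG _ (la n))); rewrite lee_wpmul2r // lee_fin /k /D1.
  rewrite -!mulrA ler_wpM2l ?(ltW C0) // -!expRD ler_expR.
  have := ler_wpM2l (ltW M0) mn; lra.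
pose k (n m : int) := (D2 * expR (- 1 * `|la n - m%:~R|))%R.
have k0 m n : (0 <= k m n)%R by rewrite mulr_ge0 ?expR_ge0 // ltW.
have kB m : lnorm r (fun n => (k n m)%:E) <= (D2 * (F * E))%:E.
  under eq_fun do rewrite EFinM.
  rewrite lnormZ //.
  rewrite [leRHS]EFinM lee_wpmul2l // ?lee_fin ?(ltW D20) //.
  (* Take [la n0] within [N] of [m]. Then [la n] has distance at least de/2 * |n - n0| - |c| - N
     from [m], so the column decays around [n0], at the price of the factor [F]. *)
  have [n0 hn0] := hN m%:~R.
  apply: (@le_trans _ _ (lnorm r (fun n => F%:E *
      (expR (- (de / 2) * `|n%:~R - n0%:~R|))%:E))); last first.
    by rewrite lnormZ // [leRHS]EFinM lee_wpmul2l // lee_fin ltW.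
  apply: lnorm_le => // n.
  rewrite -EFinM lee_fin /F -expRD ler_expR.
  have lan : (de / 2 * `|n%:~R - n0%:~R| <= `|la n - la n0| + `|c|)%R.
    have cn := ler_norm c.
    have [nn|/ltW nn] := leP n n0; have := hc _ _ nn; rewrite intrB.
      rewrite distrC ger0_norm ?subr_ge0 ?ler_int // (distrC (la n)).
      have := ler_norm (la n0 - la n); lra.
    rewrite ger0_norm ?subr_ge0 ?ler_int //.
    have := ler_norm (la n - la n0); lra.
  have := ler_distD (m%:~R) (la n) (la n0).
  rewrite (distrC m%:~R); lra.
have Gm (m : int) : 0 <= G m%:~R by [].
have := lnorm_schur r0 (ltW (mulr_gt0 D20 (mulr_gt0 F0 E0))) k0 Gm kB => h.
apply: (@le_trans _ _ ((D2 * (F * E))%:E * lnorm r (fun m => G m%:~R))); last first.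
  by rewrite lee_wpmul2r // lee_fin lerDr ltW // mulr_gt0.
apply: le_trans h; apply: lnorm_le => // n.
pose m := Num.floor (la n).
have kG0 j : 0 <= (k n j)%:E * G j%:~R by rewrite mule_ge0 // lee_fin.
apply: le_trans (le_lnorm m kG0 r0).
have mn : (`|la n - m%:~R| <= 1)%R.
  have := floor_le (la n); have := floorD1_gt (la n).
  by rewrite -/m intrD => h1 h2; rewrite ger0_norm; lra.
apply: (le_trans (GG _ m%:~R)); rewrite lee_wpmul2r // lee_fin /k /D2.
rewrite -!mulrA ler_wpM2l ?(ltW C0) // -!expRD ler_expR.
have := ler_wpM2l (ltW M0) mn; lra.
Qed.

End Reindexing.

(** * The K-functional of a quasi-normed couple *)

Section Couple.
Local Open Scope ereal_scope.
Context {R : realType} {k : scalar_kind} {V : lmodType (scalars R k)}.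
Implicit Types (X : qspace R V) (f g h : V) (u : R).

Lemma modulusN1 : modulus (-1 : scalars R k) = 1%R.
Proof. by case: k; rewrite /modulus [X in Num.norm X]/(-1)%R normrN1. Qed.

Lemma modulus0 : modulus (0 : scalars R k) = 0%R.
Proof. by case: k; rewrite /modulus normr0. Qed.

Section QuasiNormed.
Variable X : qspace R V.
Hypothesis qX : quasi_normed X.

Lemma quasi_normed0 : X 0%R. Proof. by have [[]] := qX. Qed.

Lemma quasi_normedD f g : X f -> X g -> X (f + g)%R.
Proof. by have [[_ + _] _] := qX; apply. Qed.

Lemma quasi_normedN f : X f -> X (- f)%R.
Proof. by have [[_ _ h] _] := qX => /(h (-1)%R); rewrite scaleN1r. Qed.

Lemma qnorm_ge0 f : X f -> 0 <= qnorm X f.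
Proof. by have [_ [h _ _ _]] := qX => /h /andP[]. Qed.

Lemma qnorm_lty f : X f -> qnorm X f < +oo.
Proof. by have [_ [h _ _ _]] := qX => /h /andP[]. Qed.

Lemma qnorm0 : qnorm X 0%R = 0.
Proof.
have [_ [_ _ h _]] := qX; have := h 0%R _ quasi_normed0.
by rewrite scale0r modulus0 mul0e.
Qed.

Lemma qnormN f : X f -> qnorm X (- f)%R = qnorm X f.
Proof.
have [_ [_ _ h _]] := qX => Xf; have := h (-1)%R _ Xf.
by rewrite scaleN1r modulusN1 mul1e.
Qed.

End QuasiNormed.

Variables A0 A1 : qspace R V.
Hypotheses (q0 : quasi_normed A0) (q1 : quasi_normed A1).

Lemma sumsetD f g : sumset A0 A1 f -> sumset A0 A1 g -> sumset A0 A1 (f + g)%R.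
Proof.
move=> [f0 [f1 [F0 F1 ->]]] [g0 [g1 [G0 G1 ->]]].
by exists (f0 + g0)%R, (f1 + g1)%R; split; [exact: quasi_normedD..|exact: addrACA].
Qed.

Lemma sumset0 : sumset A0 A1 0%R.
Proof. by exists 0%R, 0%R; rewrite addr0; split=> //; exact: quasi_normed0. Qed.

Lemma sumsetl f : A0 f -> sumset A0 A1 f.
Proof. by exists f, 0%R; rewrite addr0; split=> //; exact: quasi_normed0. Qed.

Lemma sumsetr f : A1 f -> sumset A0 A1 f.
Proof. by exists 0%R, f; rewrite add0r; split=> //; exact: quasi_normed0. Qed.

Lemma Kfun_ge0 u f : (0 < u)%R -> 0 <= Kfun A0 A1 u f.
Proof.
move=> u0; apply: le_ereal_inf_tmp => _ [f0 [f1 [F0 F1 _ ->]]].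
by rewrite adde_ge0 ?qnorm_ge0 // mule_ge0 ?qnorm_ge0 // lee_fin ltW.
Qed.

Lemma Kfun_le u f0 f1 : A0 f0 -> A1 f1 ->
  Kfun A0 A1 u (f0 + f1)%R <= qnorm A0 f0 + u%:E * qnorm A1 f1.
Proof. by move=> F0 F1; apply: ereal_inf_lbound; exists f0, f1. Qed.

Lemma Kfun_lel u f : A0 f -> Kfun A0 A1 u f <= qnorm A0 f.
Proof.
move=> Ff; have := Kfun_le u Ff (quasi_normed0 q1).
by rewrite addr0 qnorm0 // mule0 adde0.
Qed.

Lemma Kfun_ler u f : A1 f -> Kfun A0 A1 u f <= u%:E * qnorm A1 f.
Proof.
move=> Ff; have := Kfun_le u (quasi_normed0 q0) Ff.
by rewrite add0r qnorm0 // add0e.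
Qed.

Lemma Kfun0 u : (0 < u)%R -> Kfun A0 A1 u 0%R = 0.
Proof.
move=> u0; apply/le_anti; rewrite Kfun_ge0 // andbT.
by apply: (le_trans (Kfun_lel u (quasi_normed0 q0))); rewrite qnorm0.
Qed.

Lemma Kfun_lty u f : sumset A0 A1 f -> Kfun A0 A1 u f < +oo.
Proof.
move=> [f0 [f1 [F0 F1 ->]]]; apply: (le_lt_trans (Kfun_le u F0 F1)).
have fin1 : qnorm A1 f1 \is a fin_num by rewrite ge0_fin_numE ?qnorm_ge0 ?qnorm_lty.
by rewrite lte_add_pinfty ?qnorm_lty // -(fineK fin1) -EFinM ltry.
Qed.

Lemma KfunN u f : Kfun A0 A1 u (- f)%R = Kfun A0 A1 u f.
Proof.
have le g : Kfun A0 A1 u (- g)%R <= Kfun A0 A1 u g.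
  apply: le_ereal_inf_tmp => _ [g0 [g1 [G0 G1 -> ->]]].
  rewrite opprD -(qnormN q0 G0) -(qnormN q1 G1).
  by apply: Kfun_le; exact: quasi_normedN.
by apply/le_anti; rewrite le -{1}[f]opprK le.
Qed.

Lemma ereal_infD_ge (S T : set (\bar R)) (x : \bar R) :
  (forall s, S s -> 0 <= s) -> (forall t, T t -> 0 <= t) ->
  (forall s t, S s -> T t -> x <= s + t) -> x <= ereal_inf S + ereal_inf T.
Proof.
move=> S0 T0 h.
have s0 : 0 <= ereal_inf S by apply: le_ereal_inf_tmp.
have t0 : 0 <= ereal_inf T by apply: le_ereal_inf_tmp.
have [Sy|Sy] := eqVneq (ereal_inf S) +oo.
  by rewrite Sy addye ?leey // gt_eqF // (lt_le_trans ltNy0 t0).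
have [Ty|Ty] := eqVneq (ereal_inf T) +oo.
  by rewrite Ty addey ?leey // gt_eqF // (lt_le_trans ltNy0 s0).
have Sf : ereal_inf S \is a fin_num by rewrite ge0_fin_numE // lt_neqAle Sy leey.
have Tf : ereal_inf T \is a fin_num by rewrite ge0_fin_numE // lt_neqAle Ty leey.
apply/lee_addgt0Pr => e e0; have e20 : (0 < e / 2)%R by rewrite divr_gt0.
have [s Ss hs] := lb_ereal_inf_adherent e20 Sf.
have [t Tt ht] := lb_ereal_inf_adherent e20 Tf.
apply: (le_trans (h s t Ss Tt)).
rewrite [in leRHS](splitr e) EFinD addeACA.
by apply: leeD; exact: ltW.
Qed.

Lemma KfunD : exists2 c : R, (1 <= c)%R & forall u f g, (0 < u)%R ->
  Kfun A0 A1 u (f + g)%R <= c%:E * (Kfun A0 A1 u f + Kfun A0 A1 u g).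
Proof.
have [_ [_ _ _ [C0 hC0]]] := q0; have [_ [_ _ _ [C1 hC1]]] := q1.
pose c := Num.max 1%R (Num.max C0 C1).
have c1 : (1 <= c)%R by rewrite le_max lexx.
have cp : (0 < c)%R := lt_le_trans ltr01 c1.
exists c => // u f g u0.
rewrite -lee_pdivrMl //; apply: ereal_infD_ge.
- move=> _ [f0 [f1 [F0 F1 _ ->]]].
  by rewrite adde_ge0 ?qnorm_ge0 // mule_ge0 ?qnorm_ge0 // lee_fin ltW.
- move=> _ [f0 [f1 [F0 F1 _ ->]]].
  by rewrite adde_ge0 ?qnorm_ge0 // mule_ge0 ?qnorm_ge0 // lee_fin ltW.
move=> _ _ [f0 [f1 [F0 F1 -> ->]]] [g0 [g1 [G0 G1 -> ->]]].
rewrite lee_pdivrMl // addrACA.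
apply: (le_trans (Kfun_le u (quasi_normedD q0 F0 G0) (quasi_normedD q1 F1 G1))).
rewrite addeACA ge0_muleDr ?adde_ge0 ?mule_ge0 ?qnorm_ge0 ?lee_fin ?(ltW u0) //.
apply: leeD.
  apply: (le_trans (hC0 _ _ F0 G0)); rewrite lee_wpmul2r ?adde_ge0 ?qnorm_ge0 //.
  by rewrite lee_fin /c !le_max lexx orbT.
rewrite -ge0_muleDr ?qnorm_ge0 // muleCA lee_wpmul2l ?lee_fin ?(ltW u0) //.
apply: (le_trans (hC1 _ _ F1 G1)); rewrite lee_wpmul2r ?adde_ge0 ?qnorm_ge0 //.
by rewrite lee_fin /c !le_max lexx !orbT.
Qed.

Let K x f := Kfun A0 A1 (expR x) f.

Lemma K_quasiconcave f : quasiconcave (fun x => K x f).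
Proof. by apply: Kfun_quasiconcave => g; exact: qnorm_ge0. Qed.

(* A decomposition that is almost optimal for [K(expR n, f)]; if this value
   is [0] there may be none, but then [K(., f)] vanishes identically and
   [f + 0] serves. *)
Lemma K_decomposition : exists2 c : R, (0 < c)%R & forall f (n : R),
  sumset A0 A1 f -> exists g h,
  [/\ sumset A0 A1 g, sumset A0 A1 h, f = (g + h)%R,
      forall x, K x g <= c%:E * K (Num.min x n) f &
      forall x, K x h <= (c * expR (x - Num.max x n))%:E * K (Num.max x n) f].
Proof.
have [c c1 hc] := KfunD; have c0 : (0 < c)%R := lt_le_trans ltr01 c1.
exists (3 * c)%R => [|f n sf]; first by rewrite mulr_gt0.
have [K0 Kmono Kexp] := K_quasiconcave f.
have /orP[/eqP Kn|Kn] : (0 == K n f) || (0 < K n f) by rewrite -le_eqVlt K0.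
  exists f, 0%R; rewrite addr0; split => //; first exact: sumset0.
    move=> x; have := quasiconcave_exp (K_quasiconcave f) x n.
    rewrite -Kn mule0 => /le_trans; apply.
    by rewrite mule_ge0 // lee_fin mulr_ge0 // ltW.
  move=> x; rewrite {1}/K Kfun0 ?expR_gt0 // mule_ge0 // lee_fin.
  by rewrite mulr_ge0 ?expR_ge0 // mulr_ge0 // ltW.
have Kfin : K n f \is a fin_num by rewrite ge0_fin_numE ?K0 //; exact: Kfun_lty.
have Knr : (0 < fine (K n f))%R by rewrite fine_gt0 // Kn -ge0_fin_numE ?K0.
(* The allowed error is [K n f] itself, hence the factor 2. The constant 3 = 1 + 2 arises where one
   piece is estimated as [f] minus the other. *)
have [_ [f0 [f1 [F0 F1 fE ->]]]] := lb_ereal_inf_adherent Knr Kfin.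
rewrite -/(Kfun A0 A1 (expR n) f) -/(K n f) fineK // => hlt.
have n0 := qnorm_ge0 q0 F0; have n1 := qnorm_ge0 q1 F1.
have en1 : 0 <= (expR n)%:E * qnorm A1 f1 by rewrite mule_ge0 // lee_fin expR_ge0.
have two : K n f + K n f = 2%:E * K n f.
  by rewrite (_ : 2%:E = 1 + 1) // ge0_muleDl ?mul1e.
rewrite two in hlt.
have N0 : qnorm A0 f0 <= 2%:E * K n f by apply: le_trans (ltW hlt); rewrite leeDl.
have N1 : (expR n)%:E * qnorm A1 f1 <= 2%:E * K n f.
  by apply: le_trans (ltW hlt); rewrite leeDr.
have K1 x : K x f1 <= (2 * expR (x - n))%:E * K n f.
  apply: (le_trans (Kfun_ler _ F1)).
  rewrite (_ : expR x = expR (x - n) * expR n)%R; last by rewrite -expRD subrK.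
  rewrite EFinM -muleA mulrC EFinM -muleA lee_wpmul2l // lee_fin expR_ge0 //.
have K0' x : K x f0 <= 2%:E * K n f by apply: le_trans N0; exact: Kfun_lel.
have triple x (z : V) (y : \bar R) : K x z <= c%:E * (K x f + y) ->
    y <= 2%:E * K x f -> K x z <= (3 * c)%:E * K x f.
  move=> h hy; apply: (le_trans h).
  rewrite mulrC EFinM -muleA; apply: lee_wpmul2l; first by rewrite lee_fin ltW.
  apply: (@le_trans _ _ (K x f + 2%:E * K x f)); first by rewrite leeD2l.
  have -> : 3%:E = 1 + 2%:E :> \bar R by rewrite -EFinD; congr EFin; ring.
  by rewrite ge0_muleDl ?mul1e ?lee_fin.
have c23 : (2 <= 3 * c)%R by lra.
exists f0, f1; split; [exact: sumsetl|exact: sumsetr|exact: fE| |].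
- move=> x; have [xn|/ltW nx] := leP x n; last first.
    by apply: (le_trans (K0' x)); rewrite lee_wpmul2r ?K0 ?lee_fin.
  apply: (triple _ _ (K x f1)).
    have -> : f0 = (f + - f1)%R by rewrite fE addrK.
    by rewrite /K -(KfunN _ f1); exact: hc (expR_gt0 x).
  apply: (le_trans (K1 x)); rewrite EFinM -muleA lee_wpmul2l ?lee_fin //.
  have := Kexp _ _ xn; rewrite -lee_pdivrMl ?expR_gt0 // -expRN opprB //.
- move=> x; have [xn|/ltW nx] := leP x n.
    apply: (le_trans (K1 x)); rewrite lee_wpmul2r ?K0 // lee_fin.
    by rewrite ler_wpM2r ?expR_ge0.
  rewrite subrr expR0 mulr1; apply: (triple _ _ (K x f0)); last first.
    by apply: (le_trans (K0' x)); rewrite lee_wpmul2l ?lee_fin // Kmono.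
  have -> : f1 = (f + - f0)%R by rewrite fE addrAC subrr add0r.
  by rewrite /K -(KfunN _ f0); exact: hc (expR_gt0 x).
Qed.

End Couple.

(** * Back to the interpolation spaces: the two cases *)

Section Reiteration.
Local Open Scope ereal_scope.
Context {R : realType} {k : scalar_kind} {V : lmodType (scalars R k)}.
Variables (A0 A1 : qspace R V).
Hypotheses (qA0 : quasi_normed A0) (qA1 : quasi_normed A1).
Variables (th0 th1 : R) (q0 r0 r1 r : \bar R) (a a0 b0 b1 : R -> R).
Hypotheses (th0p : (0 < th0)%R) (th01 : (th0 < th1)%R) (th11 : (th1 < 1)%R).
Hypotheses (q0p : 0 < q0) (r0p : 0 < r0) (r1p : 0 < r1) (rp : 0 < r).
Hypotheses (sa : slowly_varying a) (sa0 : slowly_varying a0).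
Hypotheses (sb0 : slowly_varying b0) (sb1 : slowly_varying b1).
Hypothesis hfin :
  wnorm r0 `]1%R, +oo[%classic (fun s => b0 s / a0 s)%R < +oo.

Let c0 := tail_weight r0 b0 a0.
Let rho := rho_weight th0 th1 c0 b1.
Let L := interpL A0 A1 th0 r0 b0 q0 a0.
Let Y := interp A0 A1 th1 r1 b1.

Let beta (x : R) : R := (b0 (expR x) / a0 (expR x))%R.
Let T (x : R) : R :=
  fine (wnorm r0 `]expR x, +oo[%classic (fun s => b0 s / a0 s)%R).
Let W0 (x : R) : R := (expR (- th0 * x) * a0 (expR x))%R.
Let W1 (x : R) : R := (expR (- th1 * x) * b1 (expR x))%R.
Let K f (m : int) : \bar R := Kfun A0 A1 (expR m%:~R) f.

Let ra0 := regular_slowly_varying sa0.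
Let rb0 := regular_slowly_varying sb0.
Let rb1 := regular_slowly_varying sb1.

Let rbeta : regular 0 beta.
Proof. by have := regularM rb0 (regularV ra0); rewrite subr0. Qed.

Let beta0 x : (0 < beta x)%R. Proof. by have [+ _] := rbeta; exact. Qed.

Let rT : regular 0 T. Proof. exact: regular_tail r0p rbeta hfin. Qed.

Let rW0 : regular (- th0) W0.
Proof. by have := regular_interp_weight th0 ra0; rewrite addr0. Qed.

Let rW1 : regular (- th1) W1.
Proof. by have := regular_interp_weight th1 rb1; rewrite addr0. Qed.

Let tailT : exists2 A : R, (0 < A)%R & forall m : int,
  (T m%:~R)%:E <= A%:E * lnorm r0 (seqcut (fun j : int => m <= j)%R (fun j => (beta j%:~R)%:E)) /\
  lnorm r0 (seqcut (fun j : int => m <= j)%R (fun j => (beta j%:~R)%:E)) <= A%:E * (T m%:~R)%:E.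
Proof. exact: fine_wnorm_discrete r0p rbeta hfin. Qed.

Let W0p x : (0 < W0 x)%R. Proof. by have [+ _] := rW0; exact. Qed.
Let W1p x : (0 < W1 x)%R. Proof. by have [+ _] := rW1; exact. Qed.
Let Tp x : (0 < T x)%R. Proof. by have [+ _] := rT; exact. Qed.
Let c0p x : (0 < c0 (expR x))%R.
Proof.
by rewrite /c0 /tail_weight mulr_gt0 ?Tp //; have [+ _] := ra0; exact.
Qed.
Let b1p x : (0 < b1 (expR x))%R. Proof. by have [+ _] := rb1; exact. Qed.

Let rho_logE x : rho (expR x) = rho_log W0 W1 T x.
Proof.
rewrite /rho /rho_weight /rho_log /W0 /W1 -/(T x) -expRM.
have -> : c0 (expR x) = (a0 (expR x) * T x)%R by [].
have -> : (x * (th1 - th0) = - th0 * x - - th1 * x)%R by ring.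
rewrite expRB; field; rewrite !gt_eqF ?expR_gt0 //.
Qed.

Let rrho : regular (th1 - th0) (rho_log W0 W1 T).
Proof. exact: regular_rho_log. Qed.

Let rhop x : (0 < rho_log W0 W1 T x)%R. Proof. by have [+ _] := rrho; exact. Qed.

Let Kq f : quasiconcave (fun x => Kfun A0 A1 (expR x) f).
Proof. exact: K_quasiconcave. Qed.

Let Kp f m : 0 <= K f m. Proof. by have [h _ _] := Kq f; exact: h. Qed.

Let L_ge0 f : L f -> 0 <= qnorm L f. Proof. by move=> _; exact: Lnorm_ge0. Qed.
Let Y_ge0 f : Y f -> 0 <= qnorm Y f. Proof. by move=> _; exact: Lnorm_ge0. Qed.

Let LYq f : quasiconcave (fun x => Kfun L Y (expR x) f).
Proof. exact: Kfun_quasiconcave. Qed.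

Lemma sumset_LY f : sumset L Y f -> sumset A0 A1 f.
Proof. by move=> [g [h [[sg _] [sh _] ->]]]; exact: sumsetD. Qed.

Let normLK f := normL q0 r0 W0 beta (K f).
Let normYK f := normY r1 W1 (K f).
Let part1K f := part1 q0 r0 W0 beta (K f).
Let part2K f := part2 q0 W0 T (K f).
Let part3K f := part3 r1 W0 W1 T (K f).

Let part1p f n : 0 <= part1K f n.
Proof. exact: (@part1_ge0 R q0 r0 th0 W0 beta rW0 beta0 (K f) (Kp f) n). Qed.
Let part2p f n : 0 <= part2K f n.
Proof. exact: (@part2_ge0 R q0 th0 W0 T rW0 rT (K f) (Kp f) n). Qed.
Let part3p f n : 0 <= part3K f n.
Proof. exact: (@part3_ge0 R r1 th0 th1 W0 W1 T rW0 rW1 rT (K f) (Kp f) n). Qed.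

Lemma qnorm_L_discrete : exists2 A : R, (0 < A)%R & forall f,
  qnorm L f <= A%:E * normLK f /\ normLK f <= A%:E * qnorm L f.
Proof.
have [A A0p hA] := interpL_norm_discrete (V := V) th0 r0p q0p ra0 rb0.
by exists A => // f; exact: hA (Kq f).
Qed.

Lemma qnorm_Y_discrete : exists2 A : R, (0 < A)%R & forall f,
  qnorm Y f <= A%:E * normYK f /\ normYK f <= A%:E * qnorm Y f.
Proof.
have [A A0p hA] := interp_norm_discrete (V := V) th1 r1p rb1.
by exists A => // f; exact: hA (Kq f).
Qed.

Lemma part3_le_Kfun : exists2 A : R, (0 < A)%R & forall f (n : int),
  part3K f n <= A%:E * Kfun L Y (rho_log W0 W1 T n%:~R) f.
Proof.
have [c c1 hc] := KfunD qA0 qA1; have cp := lt_le_trans ltr01 c1.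
have [A A0p hA] := holmstedt_lower q0p r0p r1p th01 rW0 rW1 rT beta0 tailT cp.
have [B B0 hB] := qnorm_L_discrete; have [C C0 hC] := qnorm_Y_discrete.
exists (A * (B + C))%R => [|f n]; first by rewrite mulr_gt0 ?addr_gt0.
rewrite -lee_pdivrMl ?mulr_gt0 ?addr_gt0 //.
apply: le_ereal_inf_tmp => _ [g [h [Lg Yh -> ->]]].
rewrite lee_pdivrMl ?mulr_gt0 ?addr_gt0 //.
have hk j : K (g + h)%R j <= c%:E * (K g j + K h j) by exact: hc (expR_gt0 _).
apply: (le_trans (hA _ _ _ n (Kp _) (Kp g) (Kp h) hk)).
rewrite [X in _ <= X * _]EFinM -[leRHS]muleA lee_wpmul2l ?lee_fin ?(ltW A0p) //.
have rn0 : 0 <= (rho_log W0 W1 T n%:~R)%:E by rewrite lee_fin ltW.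
rewrite ge0_muleDr ?L_ge0 ?mule_ge0 ?Y_ge0 //; apply: leeD.
  apply: (le_trans (hB g).2); rewrite lee_wpmul2r ?L_ge0 // lee_fin lerDl ltW //.
rewrite [leRHS]muleCA lee_wpmul2l //.
by apply: (le_trans (hC h).2); rewrite lee_wpmul2r ?Y_ge0 // lee_fin lerDr ltW.
Qed.

(** Finiteness of the parts is assumed because the infimum runs over pieces in [L] and [Y]: it is
    what places the two pieces of the decomposition there. *)
Lemma Kfun_le_parts : exists2 A : R, (0 < A)%R & forall f (n : int),
  sumset A0 A1 f -> part1K f n + part2K f n + part3K f n < +oo ->
  sumset L Y f /\ Kfun L Y (rho_log W0 W1 T n%:~R) f <=
    A%:E * (part1K f n + part2K f n + part3K f n).
Proof.
have [c cp hc] := K_decomposition qA0 qA1.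
have [A A0p hA] := holmstedt_upper q0p r0p r1p th0p th11 rW0 rW1 rT beta0 tailT cp.
have [B B0 hB] := qnorm_L_discrete; have [C C0 hC] := qnorm_Y_discrete.
exists ((B + C) * A)%R => [|f n sf pfin]; first by rewrite mulr_gt0 ?addr_gt0.
have [g [h [sg sh fgh gK hK]]] := hc f n%:~R sf.
have [] := hA (K f) (K g) (K h) n (Kp f) (Kp g) (Kp h).
- by move=> j; have := gK j%:~R; rewrite /K /Order.min ltr_int; case: ifP.
- by move=> j; have := hK j%:~R; rewrite /K /Order.max ltr_int; case: ifP.
rewrite -/(normLK g) -/(normYK h) -/(part1K f) -/(part2K f) -/(part3K f).
set p1 := part1K f n; set p2 := part2K f n; set p3 := part3K f n => hL hY.
have p10 : 0 <= p1 := part1p f n.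
have p20 : 0 <= p2 := part2p f n.
have p30 : 0 <= p3 := part3p f n.
have rn0 : (0 < rho_log W0 W1 T n%:~R)%R by [].
have p12 : p1 + p2 < +oo by apply: le_lt_trans pfin; rewrite leeDl.
have p3f : p3 < +oo by apply: le_lt_trans pfin; rewrite leeDr // adde_ge0.
have hL' : qnorm L g <= (B * A)%:E * (p1 + p2).
  apply: (le_trans (hB g).1); rewrite [X in _ <= X * _]EFinM -[leRHS]muleA.
  by rewrite lee_wpmul2l ?lee_fin ?(ltW B0).
have hY' : (rho_log W0 W1 T n%:~R)%:E * qnorm Y h <= (C * A)%:E * p3.
  apply: (@le_trans _ _ ((rho_log W0 W1 T n%:~R)%:E * (C%:E * normYK h))).
    by rewrite lee_wpmul2l ?lee_fin ?(ltW rn0) //; exact: (hC h).1.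
  by rewrite muleCA [X in _ <= X * _]EFinM -[leRHS]muleA lee_wpmul2l ?lee_fin ?(ltW C0).
have Lg : L g.
  split => //; apply: (le_lt_trans hL'); apply: lte_mul_pinfty => //.
  by rewrite lee_fin mulr_ge0 // ltW.
have Yh : Y h.
  split => //; rewrite -lee_pdivlMl // in hY'; apply: (le_lt_trans hY').
  rewrite muleA -EFinM; apply: lte_mul_pinfty => //.
  by rewrite lee_fin !mulr_ge0 ?invr_ge0 // ltW.
split; first by exists g, h.
apply: (@le_trans _ _ (qnorm L g + (rho_log W0 W1 T n%:~R)%:E * qnorm Y h)).
  by apply: ereal_inf_lbound; exists g, h.
rewrite [leRHS]ge0_muleDr ?adde_ge0 //; apply: leeD.
  apply: (le_trans hL'); rewrite lee_wpmul2r ?adde_ge0 // lee_fin.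
  by rewrite ler_pM2r // lerDl ltW.
apply: (le_trans hY'); rewrite lee_wpmul2r // lee_fin.
by rewrite ler_pM2r // lerDr ltW.
Qed.

Variable th : R.
Hypothesis thp : (0 < th)%R.

(** The weight rho^(-theta) a(rho) of the outer norm, read at the point rho_n. *)
Let w (x : R) : R :=
  ((rho_log W0 W1 T x `^ th)^-1 * a (rho_log W0 W1 T x))%R.

Let rw : regular (- (th * (th1 - th0))) w.
Proof.
have := regularM (regularV (regular_powR (ltW thp) rrho)) (regular_comp sa rrho).
by rewrite addr0.
Qed.

Let wp x : (0 < w x)%R. Proof. by have [+ _] := rw; exact. Qed.

Let ga0 : (0 < th * (th1 - th0))%R. Proof. by rewrite mulr_gt0 // subr_gt0. Qed.

Lemma interp_LY_discrete : exists2 A : R, (0 < A)%R & forall f,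
  let N := lnorm r (fun n => (w n%:~R)%:E * Kfun L Y (rho_log W0 W1 T n%:~R) f) in
  qnorm (interp L Y th r a) f <= A%:E * N /\
  N <= A%:E * qnorm (interp L Y th r a) f.
Proof.
have de0 : (0 < th1 - th0)%R by rewrite subr_gt0.
have ra := regular_slowly_varying sa.
have [A A0p hA] := interp_norm_discrete (V := V) th rp ra.
have rG := regular_interp_weight th ra.
have [G0 hG] := rG; have [C C0 hC] := hG 1%R ltr01.
(* [th] accounts for the power, one unit for the slow variation of [a] and one for the
   K-functional. *)
have M0 : (0 < th + 2)%R by rewrite addr_gt0.
have [B B0 hB] := lnorm_reindex de0 rrho rp C0 M0.
exists (A * B)%R => [|f N]; first by rewrite mulr_gt0.
pose G x := (expR (- th * x) * a (expR x))%:E * Kfun L Y (expR x) f.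
have [h1 h2] := hA L Y f (LYq f).
have [K0 _ _] := LYq f.
have Gp x : 0 <= G x by rewrite mule_ge0 // lee_fin ltW //; exact: G0.
have GG x y : G x <= (C * expR ((th + 2) * `|x - y|))%:E * G y.
  have := quasiconcave_exp (LYq f) x y => hK.
  have hW := hC x y.
  apply: (le_trans (lee_pmul_scaled (ltW (G0 x)) (K0 x) hW hK)).
  apply: lee_wpmul2r; first exact: Gp.
  rewrite lee_fin -mulrA ler_wpM2l ?(ltW C0) // -expRD ler_expR.
  rewrite addr0 mul1r; have := ler_norm (- (x - y)); rewrite normrN => hn.
  have := ler_wpM2l (ltW thp) hn; lra.
have [h3 h4] := hB G Gp GG.
have GE : (fun n : int => G (ln (rho_log W0 W1 T n%:~R))) =
    (fun n => (w n%:~R)%:E * Kfun L Y (rho_log W0 W1 T n%:~R) f).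
  apply/funext => n; rewrite /G lnK ?posrE //; congr (_ %:E * _).
  by rewrite /w -powRN /powR gt_eqF.
rewrite GE in h3 h4; split.
  apply: (le_trans h1); rewrite [X in _ <= X * _]EFinM -[leRHS]muleA lee_wpmul2l // lee_fin ltW //.
apply: (le_trans h4); rewrite mulrC [X in _ <= X * _]EFinM -[leRHS]muleA.
by rewrite lee_wpmul2l // lee_fin ltW.
Qed.

Let N3 f := lnorm r (fun n => (w n%:~R)%:E * part3K f n).

Lemma interp_LY_lower : exists2 A : R, (0 < A)%R & forall f,
  N3 f <= A%:E * qnorm (interp L Y th r a) f.
Proof.
have [A A0p hA] := part3_le_Kfun; have [B B0 hB] := interp_LY_discrete.
exists (A * B)%R => [|f]; first by rewrite mulr_gt0.
apply: (@le_trans _ _ (A%:E * lnorm r (fun n => (w n%:~R)%:E *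
    Kfun L Y (rho_log W0 W1 T n%:~R) f))); last first.
  rewrite [X in _ <= X * _]EFinM -[leRHS]muleA lee_wpmul2l ?lee_fin ?(ltW A0p) //; exact: (hB f).2.
have Kn n : 0 <= Kfun L Y (rho_log W0 W1 T n%:~R) f.
  have [h _ _] := LYq f; rewrite -[rho_log _ _ _ _]lnK ?posrE //.
have Kw n : 0 <= (w n%:~R)%:E * Kfun L Y (rho_log W0 W1 T n%:~R) f.
  by rewrite mule_ge0 // lee_fin ltW.
rewrite -lnormZ //; apply: lnorm_le => // n; first by rewrite mule_ge0 // lee_fin ltW.
by rewrite [leRHS]muleCA lee_wpmul2l // lee_fin ltW.
Qed.

Lemma interp_LY_upper : exists2 A : R, (0 < A)%R & forall f,
  sumset A0 A1 f -> N3 f < +oo ->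
  sumset L Y f /\ qnorm (interp L Y th r a) f <= A%:E * N3 f.
Proof.
have [A A0p hA] := Kfun_le_parts; have [B B0 hB] := interp_LY_discrete.
have [C C0 hC] := hardy_parts q0p r0p r1p rp rW0 rW1 rT beta0 tailT ga0 rw.
exists (B * (A * C))%R => [|f sf Nfin]; first by rewrite !mulr_gt0.
have pp n : 0 <= part1K f n + part2K f n + part3K f n.
  by rewrite !adde_ge0.
have wpp n : 0 <= (w n%:~R)%:E * (part1K f n + part2K f n + part3K f n).
  by rewrite mule_ge0 // lee_fin ltW.
have hCf := hC (K f) (Kp f).
(* All the weights are positive, so a finite norm forces every term to be finite. *)
have pfin n : part1K f n + part2K f n + part3K f n < +oo.
  have : (w n%:~R)%:E * (part1K f n + part2K f n + part3K f n) < +oo.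
    apply: le_lt_trans (le_lnorm n wpp rp) _; apply: (le_lt_trans hCf).
    by apply: lte_mul_pinfty => //; rewrite lee_fin ltW.
  rewrite !ltey; apply: contraNN => /eqP ->.
  by rewrite gt0_muley // lte_fin.
split; first by have [] := hA f 0%R sf (pfin _).
apply: (le_trans (hB f).1).
rewrite [X in _ <= X * _]EFinM -[leRHS]muleA lee_wpmul2l ?lee_fin ?(ltW B0) //.
apply: (@le_trans _ _ (A%:E * lnorm r (fun n => (w n%:~R)%:E *
    (part1K f n + part2K f n + part3K f n)))); last first.
  by rewrite [X in _ <= X * _]EFinM -[leRHS]muleA lee_wpmul2l ?lee_fin ?(ltW A0p).
rewrite -lnormZ //; apply: lnorm_le => // n.
  rewrite mule_ge0 // ?lee_fin ?(ltW (wp _)) //.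
  have [h _ _] := LYq f; rewrite -[rho_log _ _ _ _]lnK ?posrE //.
rewrite [leRHS]muleCA lee_wpmul2l ?lee_fin ?(ltW (wp _)) //.
by have [] := hA f n sf (pfin _).
Qed.

(** The common end of both cases: only the target norm remains to be compared with the weighted norm
    of [part3]. *)
Lemma isomorphic_N3 (N : V -> \bar R) (A : R) : (0 < A)%R ->
  (forall f, N f <= A%:E * N3 f /\ N3 f <= A%:E * N f) ->
  isomorphic (interp L Y th r a) (finite_part A0 A1 N).
Proof.
move=> A0p hN; have [B B0 hB] := interp_LY_lower; have [C C0 hC] := interp_LY_upper.
have low f : N f <= (A * B)%:E * qnorm (interp L Y th r a) f.
  apply: (le_trans (hN f).1); rewrite [X in _ <= X * _]EFinM -[leRHS]muleA.
  by rewrite lee_wpmul2l ?lee_fin ?(ltW A0p).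
have N3fin f : N f < +oo -> N3 f < +oo.
  move=> Nf; apply: (le_lt_trans (hN f).2).
  by apply: lte_mul_pinfty; rewrite ?lee_fin ?(ltW A0p).
have up f : sumset A0 A1 f -> N f < +oo ->
    sumset L Y f /\ qnorm (interp L Y th r a) f <= (C * A)%:E * N f.
  move=> sf Nf; have [sLY h] := hC f sf (N3fin f Nf); split => //.
  apply: (le_trans h); rewrite [X in _ <= X * _]EFinM -[leRHS]muleA.
  by rewrite lee_wpmul2l ?lee_fin ?(ltW C0) //; exact: (hN f).2.
split; split.
- move=> f [sf Nf]; split; first exact: sumset_LY.
  apply: (le_lt_trans (low f)); apply: lte_mul_pinfty => //.
  by rewrite lee_fin mulr_ge0 // ltW.
- by exists (A * B)%R => f _; exact: low.
- move=> f [sf Nf]; have [sLY h] := up f sf Nf; split => //.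
  apply: (le_lt_trans h); apply: lte_mul_pinfty => //.
  by rewrite lee_fin mulr_ge0 // ltW.
- by exists (C * A)%R => f [sf Nf]; have [] := up f sf Nf.
Qed.

(** The origin of eta and of the new slowly varying function: rho^(-theta) t^(-theta_0) c_0 has the
    power theta_0 + theta (theta_1 - theta_0) = eta of 1/t, and c_0^(1 - theta) b_1^theta
    remains. *)
Let discrete_weight x :
  (w x * (W0 x * T x) =
   expR (- ((1 - th) * th0 + th * th1) * x) *
   (c0 (expR x) `^ (1 - th) * b1 (expR x) `^ th * a (rho (expR x))))%R.
Proof.
rewrite /w -rho_logE.
have rE : (rho (expR x) `^ th = expR (th * (th1 - th0) * x) *
    c0 (expR x) `^ th * (b1 (expR x) `^ th)^-1)%R.
  rewrite /rho /rho_weight -expRM powRM ?divr_ge0 ?expR_ge0 ?(ltW (c0p x)) ?(ltW (b1p x)) //.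
  rewrite powRM ?invr_ge0 ?(ltW (c0p x)) ?(ltW (b1p x)) // -expRM mulrA.
  congr (expR _ * _ * _)%R; first by ring.
  by rewrite -[in LHS]powR_inv1 ?(ltW (b1p x)) // -powRrM mulN1r powRN.
have -> : (c0 (expR x) `^ (1 - th) = c0 (expR x) * (c0 (expR x) `^ th)^-1)%R.
  rewrite powRD ?powRr1 ?powRN //; first exact: ltW.
  by rewrite (gt_eqF (c0p x)) implybT.
have -> : (W0 x * T x = expR (- th0 * x) * c0 (expR x))%R by rewrite /W0 -mulrA.
rewrite rE.
have -> : (expR (- ((1 - th) * th0 + th * th1) * x) =
    expR (- th0 * x) * (expR (th * (th1 - th0) * x))^-1)%R.
  by rewrite -expRN -expRD; congr expR; ring.
field.
by rewrite !gt_eqF ?expR_gt0 ?powR_gt0.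
Qed.

Lemma reiteration_interp : (th < 1)%R ->
  isomorphic (interp L Y th r a)
    (interp A0 A1 ((1 - th) * th0 + th * th1) r
      (fun t => c0 t `^ (1 - th) * b1 t `^ th * a (rho t))%R).
Proof.
move=> th1s; set eta := ((1 - th) * th0 + th * th1)%R.
set ash := fun t => _.
have rc0 : regular 0 (c0 \o expR) by have := regularM ra0 rT; rewrite addr0.
have rash : regular 0 (ash \o expR).
  have th1m : (0 <= 1 - th)%R by rewrite subr_ge0 ltW.
  have := regularM (regularM (regular_powR th1m rc0) (regular_powR (ltW thp) rb1))
    (regular_comp sa rrho).
  rewrite !mulr0 !addr0; congr regular.
  by apply/funext => x; rewrite /ash /= rho_logE.
have [B B0 hB] := interp_norm_discrete (V := V) eta rp rash.
have gad : (th * (th1 - th0) < th1 - th0)%R.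
  by rewrite gtr_pMl // subr_gt0.
have [C C0 hC] := hardy_part3 r1p rp rW0 rW1 rT rw gad.
pose D f := lnorm r (fun n => (w n%:~R)%:E * ((W0 n%:~R * T n%:~R)%:E * K f n)).
have DE f : lnorm r (discreteK A0 A1 eta ash f) = D f.
  congr lnorm; apply/funext => n; rewrite /D /discreteK muleA -EFinM.
  by congr (_ %:E * _); rewrite -discrete_weight.
have wTp n : (0 < W0 n%:~R * T n%:~R)%R by rewrite mulr_gt0.
have D0 f : 0 <= D f.
  apply: lnorm_ge0 => n; rewrite mule_ge0 ?lee_fin ?(ltW (wp _)) //.
  by rewrite mule_ge0 ?lee_fin ?(ltW (wTp _)).
have D3 f : D f <= N3 f.
  apply: lnorm_le => // n.
    by rewrite mule_ge0 ?mule_ge0 ?lee_fin ?(ltW (wp _)) ?(ltW (wTp _)).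
  rewrite lee_wpmul2l ?lee_fin ?(ltW (wp _)) //.
  exact: (le_part3 r1p rW0 rW1 rT (Kp f)).
have ND f : N3 f <= C%:E * D f by exact: hC (Kp f).
have N30 f : 0 <= N3 f by apply: le_trans (D3 f).
have BC0 : (0 < B + C * B)%R by rewrite addr_gt0 // mulr_gt0.
apply: (isomorphic_N3 BC0) => f.
have [h1 h2] := hB A0 A1 f (Kq f); rewrite DE in h1 h2; split.
  apply: (le_trans h1); apply: lee_pmul => //; rewrite ?lee_fin ?(ltW B0) //.
  by rewrite lerDl mulr_ge0 // ltW.
apply: (le_trans (ND f)); apply: (@le_trans _ _ ((C * B)%:E *
    qnorm (interp A0 A1 eta r ash) f)).
  by rewrite EFinM -muleA lee_wpmul2l ?lee_fin ?(ltW C0).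
by rewrite lee_wpmul2r ?Lnorm_ge0 // lee_fin lerDr ltW.
Qed.

Lemma reiteration_interpR : th = 1%R ->
  isomorphic (interp L Y th r a)
    (interpR A0 A1 th1 r (fun t => b1 t * a (rho t))%R r1 b1).
Proof.
move=> th1E; set ash := fun t => _.
have rash : regular 0 (ash \o expR).
  have := regularM rb1 (regular_comp sa rrho); rewrite addr0; congr regular.
  by apply/funext => x; rewrite /ash /= rho_logE.
have [B B0 hB] := interpR_norm_discrete (V := V) th1 rp r1p rb1 rash.
apply: (isomorphic_N3 B0) => f; have := hB A0 A1 f (Kq f).
set D := lnorm r _; suff -> : N3 f = D by [].
(* For theta = 1 the factor rho of [part3] cancels the one in [w], leaving a(rho), the quotient of
   the new weight by b_1 that the R norm carries. *)
congr lnorm; apply/funext => m; rewrite /part3K /part3 muleA -EFinM.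
congr (_ %:E * _); rewrite /w th1E powRr1 ?(ltW (rhop _)) // /ash rho_logE.
by field; rewrite !gt_eqF.
Qed.

End Reiteration.

Theorem theorem11 (R : realType) (k : scalar_kind)
    (V : topologicalLmodType (scalars R k)) (A0 A1 : qspace R V)
    (theta0 theta1 : R) (q0 r0 r1 r : \bar R) (a a0 b0 b1 : R -> R)
    (hA : compatible_couple A0 A1)
    (hA01 : exists x : V, [/\ A0 x, A1 x & x <> 0])
    (htheta0 : 0 < theta0) (htheta01 : theta0 < theta1) (htheta1 : theta1 < 1)
    (hq0 : (0 < q0)%E) (hr0 : (0 < r0)%E) (hr1 : (0 < r1)%E) (hr : (0 < r)%E)
    (ha : slowly_varying a) (ha0 : slowly_varying a0)
    (hb0 : slowly_varying b0) (hb1 : slowly_varying b1)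
    (hfin : (wnorm r0 `]1%R, +oo[ (fun s => b0 s / a0 s)%R < +oo)%E) :
  let c0 := tail_weight r0 b0 a0 in
  let rho := rho_weight theta0 theta1 c0 b1 in
  let L := interpL A0 A1 theta0 r0 b0 q0 a0 in
  let Y := interp A0 A1 theta1 r1 b1 in
  (forall theta : R, 0 < theta -> theta < 1 ->
     let eta := (1 - theta) * theta0 + theta * theta1 in
     let a_sharp := fun t : R =>
       c0 t `^ (1 - theta) * b1 t `^ theta * a (rho t) in
     isomorphic (interp L Y theta r a) (interp A0 A1 eta r a_sharp)) /\
  ((wnorm r `]0%R, 1%R[ a < +oo)%E ->
     let a_sharp := fun t : R => b1 t * a (rho t) in
     isomorphic (interp L Y 1 r a) (interpR A0 A1 theta1 r a_sharp r1 b1)).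
Proof.
move=> c0 rho L Y; have [_ [qA0 _] [qA1 _] _ _] := hA.
split=> [theta theta_gt0 theta_lt1|_] /=.
  exact: reiteration_interp.
exact: reiteration_interpR.
Qed.
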